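(* Consider the representation of the algebra $\mathrm{AW}_2$ on $V_1\otimes V_2$ and the basis $\{\psi_{n_1}^{n_2}\otimes\psi_{n_2}\}$ of $V_1\otimes V_2$ described in the context, on which $L_2$ acts as the 9-term operator $$L_2(\psi_{n_1}^{n_2}\otimes\psi_{n_2})=a_{n_1,n_2}\,\psi_{n_1-1}^{n_2-1}\otimes\psi_{n_2-1}+b_{n_1,n_2}\,\psi_{n_1-1}^{n_2}\otimes\psi_{n_2}+c_{n_1,n_2}\,\psi_{n_1-1}^{n_2+1}\otimes\psi_{n_2+1}$$ $$+d_{n_1,n_2}\,\psi_{n_1}^{n_2-1}\otimes\psi_{n_2-1}+e_{n_1,n_2}\,\psi_{n_1}^{n_2}\otimes\psi_{n_2}+d_{n_1,n_2+1}\,\psi_{n_1}^{n_2+1}\otimes\psi_{n_2+1}$$ $$+c_{n_1+1,n_2-1}\,\psi_{n_1+1}^{n_2-1}\otimes\psi_{n_2-1}+b_{n_1+1,n_2}\,\psi_{n_1+1}^{n_2}\otimes\psi_{n_2}+a_{n_1+1,n_2+1}\,\psi_{n_1+1}^{n_2+1}\otimes\psi_{n_2+1}.$$ The coefficients are given by $$a_{n_1,n_2}=\frac{a_{n_1}(\boldsymbol\alpha_{L_1}^{n_2})\,d_{n_1-1,n_2}-a_{n_1}(\boldsymbol\alpha_{L_1}^{n_2-1})\,d_{n_1,n_2}}{b_{n_1-1}(\boldsymbol\alpha_{L_1}^{n_2-1})-b_{n_1}(\boldsymbol\alpha_{L_1}^{n_2})},$$ $$b_{n_1,n_2}=\frac{a_{n_1}(\boldsymbol\alpha_{L_1}^{n_2})\big(A_0\lambda_{n_2}+\cosh_q(1)A_{N_2}\big)}{\cosh_q(2n_2+\alpha_0-1)\cosh_q(2n_2+\alpha_0+1)},$$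 $$c_{n_1,n_2}=\frac{a_{n_1}(\boldsymbol\alpha_{L_1}^{n_2})\,d_{n_1-1,n_2+1}-a_{n_1}(\boldsymbol\alpha_{L_1}^{n_2+1})\,d_{n_1,n_2+1}}{b_{n_1-1}(\boldsymbol\alpha_{L_1}^{n_2+1})-b_{n_1}(\boldsymbol\alpha_{L_1}^{n_2})},$$ $$d_{n_1,n_2}=\frac{\tilde a_{n_2}(\boldsymbol\alpha_{M_2}^{n_1})\big(\cosh_q(1)A_1-A_2\lambda_{n_1}\big)}{\cosh_q(2n_1+\alpha_0-1)\cosh_q(2n_1+\alpha_0+1)},$$ $$e_{n_1,n_2}=\frac{\tilde b_{n_2}(\boldsymbol\alpha_{M_2}^{n_1})\big(\cosh_q(1)A_1-A_2\lambda_{n_1}\big)+A_0\big(A_1\lambda_{n_1}+\cosh_q(1)A_2\big)}{\cosh_q(2n_1+\alpha_0-1)\cosh_q(2n_1+\alpha_0+1)},$$ where $\boldsymbol\alpha_{L_1}^{n_2}=(\alpha_0+2n_2,\alpha_1,\alpha_2,-N_1-1)$, $\boldsymbol\alpha_{M_2}^{n_1}=(\alpha_0,-N_1-1,-\alpha_0-2n_1,-N_2-1)$, and the functions $a_n,b_n,\tilde a_n,\tilde b_n$ of a vector in $\mathbb{R}^4$ are given in the context.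
   Context: Notation: $0<q<1$, $\sinh_q(x)=q^x-q^{-x}$, $\cosh_q(x)=q^x+q^{-x}$. Coefficient functions: for $\boldsymbol\beta=(\beta_0,\beta_1,\beta_2,\beta_3)\in\mathbb{R}^4$, $a_n(\boldsymbol\beta)$ is a square root of $$a_n^2(\boldsymbol\beta)=\frac{-\prod_{k=0}^3\big(\sinh_q(2n+\beta_0-1)-\sinh_q(p_k)\big)}{\cosh_q(2n+\beta_0-1)^2\cosh_q(2n+\beta_0)\cosh_q(2n+\beta_0-2)},$$ with $p_0=\beta_0+\beta_3$, $p_1=\beta_0-\beta_3$, $p_2=\beta_1+\beta_2$, $p_3=\beta_1-\beta_2$; $$b_n(\boldsymbol\beta)=\frac{(B_0B_1-B_2B_3)\sinh_q(2n+\beta_0)+\cosh_q(1)(B_1B_3+B_0B_2)}{\cosh_q(2n+\beta_0-1)\cosh_q(2n+\beta_0+1)},$$ with $B_0=\sinh_q(\beta_0)$, $B_1=\sinh_q(\beta_1)$, $B_2=\cosh_q(\beta_2)$, $B_3=\cosh_q(\beta_3)$. Further, $\tilde a_n(\boldsymbol\beta)$ is a square root of $\tilde a_n^2(\beta_0,\beta_1,\beta_2,\beta_3)=-a_n^2(\beta_0,\beta_2,\beta_1,\beta_3)$, and $$\tilde b_n(\boldsymbol\beta)=\frac{(\tilde B_0\tilde B_1-\tilde B_2\tilde B_3)\sinh_q(2n+\beta_0)+\cosh_q(1)(\tilde B_1\tilde B_3+\tilde B_0\tilde B_2)}{\cosh_q(2n+\beta_0-1)\cosh_q(2n+\beta_0+1)},$$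 with $\tilde B_0=\sinh_q(\beta_0)$, $\tilde B_1=\cosh_q(\beta_1)$, $\tilde B_2=\sinh_q(\beta_2)$, $\tilde B_3=\cosh_q(\beta_3)$. AW-relations: for elements $K,L,A_0,\dots,A_5$ of a unital algebra, $\mathscr{AW}(K,L\mid A_0,\dots,A_5)=0$ means $$\cosh_q(2)KLK-K^2L-LK^2=(\sinh_q(1))^2(A_0A_1-A_2A_3)K-(\cosh_q(1))^2A_5L+\cosh_q(1)(A_1A_3A_5+(\sinh_q(1))^2A_0A_2),$$ $$\cosh_q(2)LKL-L^2K-KL^2=(\sinh_q(1))^2(A_0A_1-A_2A_3)L-(\cosh_q(1))^2A_4K+\cosh_q(1)(A_0A_3A_4+(\sinh_q(1))^2A_1A_2).$$ The structure parameters $A_0,\dots,A_5$ are locally central if they commute with each other and with $K$ and $L$. The algebra $\mathrm{AW}_2$, for real constants $A_0,A_1,A_2,A_{N_1},A_{N_2},\sigma_K,\sigma_L$: for $i=1,2$ let $\mathrm{AW}_1(A_{N_i})$ be the unital algebra generated by $K_1,L_1$ with $\mathscr{AW}(K_1,L_1\mid A_0,A_1,A_2,A_{N_i},\sigma_L,\sigma_K)=0$; let $\mathscr{A}=\mathrm{AW}_1(A_{N_1})\otimes\mathrm{AW}_1(A_{N_2})$; let $\mathrm{AW}_1(M_2)$ be the unital algebra generated by $K_2,L_2$ and a central element $M_2$ with $\mathscr{AW}(K_2,L_2\mid A_0,A_1,A_2,M_2,\sigma_L,\sigma_K)=0$. Then $\mathrm{AW}_2$ is the unital associative complex algebra generated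 by $\mathscr{A}$ and $\mathrm{AW}_1(M_2)$ (free product) subject to $$\mathscr{AW}(1\otimes K_1,L_2\mid A_0,L_1\otimes1,A_2,A_{N_2},\sigma_L,\sigma_K)=0,\qquad \mathscr{AW}(K_2,L_1\otimes1\mid1\otimes K_1,A_1,A_2,A_{N_1},\sigma_L,\sigma_K)=0,$$ $$\mathscr{AW}(1\otimes K_1,M_2\mid A_0,A_{N_1},-K_2,A_{N_2},-(\sinh_q(1))^2,\sigma_K)=0,\qquad \mathscr{AW}(M_2,L_1\otimes1\mid A_{N_2},A_1,-L_2,A_{N_1},\sigma_L,-(\sinh_q(1))^2)=0,$$ where in each relation all structure parameters are locally central. The representation: $N_1,N_2\in\mathbb{Z}_{\ge0}$, $\alpha_0,\alpha_1,\alpha_2\in\mathbb{R}$, $A_0=\sinh_q(\alpha_0)$, $A_1=\sinh_q(\alpha_1)$, $A_2=\cosh_q(\alpha_2)$, $A_{N_i}=\cosh_q(-N_i-1)$, $\sigma_K=\sigma_L=(\sinh_q(1))^2$, $\lambda_x=\sinh_q(2x+\alpha_0)$, $\mu_x=\sinh_q(2x+\alpha_1)$. $V_1,V_2$ are complex inner product spaces with $\dim V_i=N_i+1$, and $V_1\otimes V_2$ has the product inner product. $\mathrm{AW}_2$ acts on $V_1\otimes V_2$ so that $\mathscr{A}$ acts as the tensor product of representations of $\mathrm{AW}_1(A_{N_i})$ on $V_i$ in which $K_1$ has the simple eigenvalues $\lambda_{k-N_i/2}$ and $L_1$ the simple eigenvalues $\mu_{k-N_i/2}$ ($0\le k\le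 N_i$); the operators $1\otimes K_1$, $L_1\otimes1$, $K_2$, $L_2$, $M_2$ are self-adjoint. Basis: $\psi_{n_2}\in V_2$, $n_2\in\{-\frac{N_2}2,-\frac{N_2}2+1,\dots,\frac{N_2}2\}$, are orthonormal with $K_1\psi_{n_2}=\lambda_{n_2}\psi_{n_2}$; for each $n_2$, $\{\psi_{n_1}^{n_2}\}$ with $n_1\in\{n_2-\frac{N_1}2,\dots,n_2+\frac{N_1}2\}$ is an orthonormal basis of $V_1$ with $K_2(\psi_{n_1}^{n_2}\otimes\psi_{n_2})=\lambda_{n_1}\psi_{n_1}^{n_2}\otimes\psi_{n_2}$. Vectors with indices outside these ranges are read as $0$.
   Formalization: Corrected: a_n, b_n at α_{L1}^{n2} are taken at n = n1−n2 (shifted likewise) instead of n1; ã_n²(β) = −a_n²(β0,−β2,β1,β3); denominators of the occurring a_{n1,n2}, c_{n1,n2} are assumed nonzero; the formula holds after suitable phases of the basis and choices of square roots. *)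

(* Defs.v *)
From HB Require Import structures.
From mathcomp Require Import all_boot all_order all_algebra.
From mathcomp Require Import sesquilinear complex.
From mathcomp Require Import reals exp.

Set Implicit Arguments.
Unset Strict Implicit.
Unset Printing Implicit Defensive.

Import Order.TTheory GRing.Theory Num.Theory.
Local Open Scope ring_scope.
Local Open Scope complex_scope.

Definition sinhq (R : realType) (q x : R) : R := q `^ x - q `^ (- x).
Definition coshq (R : realType) (q x : R) : R := q `^ x + q `^ (- x).

Definition asq (R : realType) (q n : R) (beta : R * R * R * R) : R :=
  let: (b0, b1, b2, b3) := beta in
  - (\prod_(p <- [:: b0 + b3; b0 - b3; b1 + b2; b1 - b2])
       (sinhq q (2 * n + b0 - 1) - sinhq q p))
  / (coshq q (2 * n + b0 - 1) ^+ 2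
     * coshq q (2 * n + b0) * coshq q (2 * n + b0 - 2)).

(* The common shape of b_n and its tilde version, which differ only in the
   meaning of B1 and B2. *)
Definition bform (R : realType) (q n b0 B0 B1 B2 B3 : R) : R :=
  ((B0 * B1 - B2 * B3) * sinhq q (2 * n + b0)
     + coshq q 1 * (B1 * B3 + B0 * B2))
  / (coshq q (2 * n + b0 - 1) * coshq q (2 * n + b0 + 1)).

Definition bcoef (R : realType) (q n : R) (beta : R * R * R * R) : R :=
  let: (b0, b1, b2, b3) := beta in
  bform q n b0 (sinhq q b0) (sinhq q b1) (coshq q b2) (coshq q b3).

(* The sign of b2 makes this vanish at both ends of each M2-ladder (n1 fixed);
   with +b2 the operator M2 would not satisfy its defining relations. *)
Definition tasq (R : realType) (q n : R) (beta : R * R * R * R) : R :=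
  let: (b0, b1, b2, b3) := beta in - asq q n (b0, - b2, b1, b3).

Definition tbcoef (R : realType) (q n : R) (beta : R * R * R * R) : R :=
  let: (b0, b1, b2, b3) := beta in
  bform q n b0 (sinhq q b0) (coshq q b1) (sinhq q b2) (coshq q b3).

(* The product of 'End(V).  The library notation \o has the precedence of
   + and -, hence this one. *)
Local Notation "f ** g" := (comp_lfun f g) (at level 40, left associativity).

Definition AW_rel (R : realType) (q : R) (V : vectType R[i])
    (K L A0 A1 A2 A3 A4 A5 : 'End(V)) : Prop :=
  let s2 := ((sinhq q 1) ^+ 2)%:C in
  let c1 := (coshq q 1)%:C in
  let c2 := (coshq q 2)%:C in
  let B := A0 ** A1 - A2 ** A3 in
  (c2 *: (K ** L ** K) - K ** K ** L - L ** K ** K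
     = s2 *: (B ** K) - c1 ^+ 2 *: (A5 ** L)
       + c1 *: (A1 ** A3 ** A5 + s2 *: (A0 ** A2)))
  /\
  (c2 *: (L ** K ** L) - L ** L ** K - K ** L ** L
     = s2 *: (B ** L) - c1 ^+ 2 *: (A4 ** K)
       + c1 *: (A0 ** A3 ** A4 + s2 *: (A1 ** A2))).

Definition commuting (R : realType) (V : vectType R[i]) (s : seq 'End(V)) :=
  forall f g, f \in s -> g \in s -> f ** g = g ** f.

(* AW(K, L | A0, ..., A5) = 0 with locally central structure parameters. *)
Definition AW (R : realType) (q : R) (V : vectType R[i])
    (K L A0 A1 A2 A3 A4 A5 : 'End(V)) : Prop :=
  [/\ AW_rel q K L A0 A1 A2 A3 A4 A5,
      commuting [:: K; A0; A1; A2; A3; A4; A5] &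
      commuting [:: L; A0; A1; A2; A3; A4; A5]].

Definition scal (R : realType) (V : vectType R[i]) (x : R) : 'End(V) :=
  (x%:C *: \1)%VF.
Arguments scal {R} V x.

Record aw_data (R : realType) := AWData {
  qq : R; al0 : R; al1 : R; al2 : R; N1 : nat; N2 : nat }.

Definition A0c (R : realType) (p : aw_data R) : R := sinhq (qq p) (al0 p).
Definition A1c (R : realType) (p : aw_data R) : R := sinhq (qq p) (al1 p).
Definition A2c (R : realType) (p : aw_data R) : R := coshq (qq p) (al2 p).
Definition ANc (R : realType) (p : aw_data R) (N : nat) : R :=
  coshq (qq p) (- N%:R - 1).
(* The common value of sigma_K and sigma_L in the representation. *)
Definition sigc (R : realType) (p : aw_data R) : R := (sinhq (qq p) 1) ^+ 2.

Definition lam (R : realType) (p : aw_data R) (x : R) : R :=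
  sinhq (qq p) (2 * x + al0 p).
Definition mu (R : realType) (p : aw_data R) (x : R) : R :=
  sinhq (qq p) (2 * x + al1 p).

Definition self_adjoint (R : realType) (V : vectType R[i])
    (dot : {dot V for (@Num.conj R[i])}) (f : 'End(V)) : Prop :=
  forall u v, dot (f u) v = dot u (f v).

(* (W, tens) is the tensor product of V1 and V2 with the product inner
   product: pure tensors span W and, the product form being positive definite,
   tensors of orthonormal bases are linearly independent. *)
Definition is_tensor_product (R : realType) (V1 V2 W : vectType R[i])
    (dot1 : {dot V1 for (@Num.conj R[i])})
    (dot2 : {dot V2 for (@Num.conj R[i])})
    (dotW : {dot W for (@Num.conj R[i])})
    (tens : {bilinear V1 -> V2 -> W}) : Prop :=
  (forall w, exists s : seq (V1 * V2), w = \sum_(x <- s) tens x.1 x.2)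
  /\ (forall u u' v v', dotW (tens u v) (tens u' v') = dot1 u u' * dot2 v v').

Definition is_tensor_op (R : realType) (V1 V2 W : vectType R[i])
    (tens : {bilinear V1 -> V2 -> W}) (f : 'End(V1)) (g : 'End(V2))
    (h : 'End(W)) : Prop :=
  forall u v, h (tens u v) = tens (f u) (g v).

Definition is_AW1_rep (R : realType) (p : aw_data R) (N : nat)
    (V : vectType R[i]) (K1 L1 : 'End(V)) : Prop :=
  [/\ AW (qq p) K1 L1 (scal V (A0c p)) (scal V (A1c p)) (scal V (A2c p))
        (scal V (ANc p N)) (scal V (sigc p)) (scal V (sigc p)),
      forall k : nat, (k <= N)%N ->
        \dim (passmx.leigenspace K1 (lam p (k%:R - N%:R / 2))%:C) = 1%N &
      forall k : nat, (k <= N)%N ->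
        \dim (passmx.leigenspace L1 (mu p (k%:R - N%:R / 2))%:C) = 1%N].

(* Images of the generators of AW2: K1_i, L1_i act on V_i; K1x, L1x, xK1, xL1
   stand for K1 (x) 1, L1 (x) 1, 1 (x) K1, 1 (x) L1 on W. *)
Record aw2_ops (R : realType) (V1 V2 W : vectType R[i]) := AW2Ops {
  K1_1 : 'End(V1); L1_1 : 'End(V1);
  K1_2 : 'End(V2); L1_2 : 'End(V2);
  K1x : 'End(W); L1x : 'End(W); xK1 : 'End(W); xL1 : 'End(W);
  K2 : 'End(W); L2 : 'End(W); M2 : 'End(W) }.

(* An action of an algebra given by generators and relations is a choice of
   operators, one for each generator, satisfying the relations. *)
Record is_AW2_rep (R : realType) (p : aw_data R) (V1 V2 W : vectType R[i])
    (dotW : {dot W for (@Num.conj R[i])}) (tens : {bilinear V1 -> V2 -> W})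
    (T : aw2_ops V1 V2 W) : Prop := IsAW2Rep {
  rep_V1 : is_AW1_rep p (N1 p) (K1_1 T) (L1_1 T);
  rep_V2 : is_AW1_rep p (N2 p) (K1_2 T) (L1_2 T);
  rep_K1x : is_tensor_op tens (K1_1 T) \1%VF (K1x T);
  rep_L1x : is_tensor_op tens (L1_1 T) \1%VF (L1x T);
  rep_xK1 : is_tensor_op tens \1%VF (K1_2 T) (xK1 T);
  rep_xL1 : is_tensor_op tens \1%VF (L1_2 T) (xL1 T);
  rep_K2L2 : AW (qq p) (K2 T) (L2 T)
    (scal W (A0c p)) (scal W (A1c p)) (scal W (A2c p)) (M2 T)
    (scal W (sigc p)) (scal W (sigc p));
  rep_K1L2 : AW (qq p) (xK1 T) (L2 T)
    (scal W (A0c p)) (L1x T) (scal W (A2c p)) (scal W (ANc p (N2 p)))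
    (scal W (sigc p)) (scal W (sigc p));
  rep_K2L1 : AW (qq p) (K2 T) (L1x T)
    (xK1 T) (scal W (A1c p)) (scal W (A2c p)) (scal W (ANc p (N1 p)))
    (scal W (sigc p)) (scal W (sigc p));
  rep_K1M2 : AW (qq p) (xK1 T) (M2 T)
    (scal W (A0c p)) (scal W (ANc p (N1 p))) (- K2 T)
    (scal W (ANc p (N2 p)))
    (scal W (- (sinhq (qq p) 1) ^+ 2)) (scal W (sigc p));
  rep_M2L1 : AW (qq p) (M2 T) (L1x T)
    (scal W (ANc p (N2 p))) (scal W (A1c p)) (- L2 T)
    (scal W (ANc p (N1 p)))
    (scal W (sigc p)) (scal W (- (sinhq (qq p) 1) ^+ 2));
  rep_sa_xK1 : self_adjoint dotW (xK1 T);
  rep_sa_L1x : self_adjoint dotW (L1x T);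
  rep_sa_K2 : self_adjoint dotW (K2 T);
  rep_sa_L2 : self_adjoint dotW (L2 T);
  rep_sa_M2 : self_adjoint dotW (M2 T) }.

Definition range2 (R : realType) (p : aw_data R) (n2 : R) : Prop :=
  exists2 k : nat, (k <= N2 p)%N & n2 = k%:R - (N2 p)%:R / 2.

Definition range12 (R : realType) (p : aw_data R) (n1 n2 : R) : Prop :=
  range2 p n2 /\
  exists2 j : nat, (j <= N1 p)%N & n1 = n2 + j%:R - (N1 p)%:R / 2.

(* psi1 n1 n2 is the vector with lower index n1 and upper index n2.  Each
   orthonormal family has as many members as the dimension of its space. *)
Record is_eigenbasis (R : realType) (p : aw_data R) (V1 V2 W : vectType R[i])
    (dot1 : {dot V1 for (@Num.conj R[i])})
    (dot2 : {dot V2 for (@Num.conj R[i])})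
    (tens : {bilinear V1 -> V2 -> W}) (T : aw2_ops V1 V2 W)
    (psi1 : R -> R -> V1) (psi2 : R -> V2) : Prop := IsEigenbasis {
  psi2_out : forall n2, ~ range2 p n2 -> psi2 n2 = 0;
  psi1_out : forall n1 n2, ~ range12 p n1 n2 -> psi1 n1 n2 = 0;
  psi2_on : forall n2 m2, range2 p n2 -> range2 p m2 ->
    dot2 (psi2 n2) (psi2 m2) = (n2 == m2)%:R;
  psi1_on : forall n1 m1 n2, range12 p n1 n2 -> range12 p m1 n2 ->
    dot1 (psi1 n1 n2) (psi1 m1 n2) = (n1 == m1)%:R;
  psi2_eig : forall n2, range2 p n2 ->
    K1_2 T (psi2 n2) = (lam p n2)%:C *: psi2 n2;
  psi1_eig : forall n1 n2, range12 p n1 n2 ->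
    K2 T (tens (psi1 n1 n2) (psi2 n2))
      = (lam p n1)%:C *: tens (psi1 n1 n2) (psi2 n2) }.

Definition alphaL (R : realType) (p : aw_data R) (n2 : R) : R * R * R * R :=
  (al0 p + 2 * n2, al1 p, al2 p, - (N1 p)%:R - 1).
Definition alphaM (R : realType) (p : aw_data R) (n1 : R) : R * R * R * R :=
  (al0 p, - (N1 p)%:R - 1, - al0 p - 2 * n1, - (N2 p)%:R - 1).

(* A square-root function for asq (or tasq) on all arguments. *)
Definition is_sqrt (R : realType) (f : R -> R * R * R * R -> R)
    (r : R -> R * R * R * R -> R[i]) : Prop :=
  forall n beta, r n beta ^+ 2 = (f n beta)%:C.

(* In the AW1-representation with first parameter alpha0 + 2 n2, the vector
   with K2-eigenvalue lam n1 = sinhq (2 (n1 - n2) + (alpha0 + 2 n2)) sits at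
   position n1 - n2 of the ladder, whose ends are -N1/2 and N1/2. *)
Definition aL (R : realType) (p : aw_data R) (ra : R -> R * R * R * R -> R[i])
    (n1 n2 : R) : R[i] := ra (n1 - n2) (alphaL p n2).
Definition bL (R : realType) (p : aw_data R) (n1 n2 : R) : R :=
  bcoef (qq p) (n1 - n2) (alphaL p n2).

Definition den (R : realType) (p : aw_data R) (n : R) : R :=
  coshq (qq p) (2 * n + al0 p - 1) * coshq (qq p) (2 * n + al0 p + 1).

Definition coef_b (R : realType) (p : aw_data R)
    (ra : R -> R * R * R * R -> R[i]) (n1 n2 : R) : R[i] :=
  aL p ra n1 n2
  * (A0c p * lam p n2 + coshq (qq p) 1 * ANc p (N2 p))%:C / (den p n2)%:C.

Definition coef_d (R : realType) (p : aw_data R)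
    (rta : R -> R * R * R * R -> R[i]) (n1 n2 : R) : R[i] :=
  rta n2 (alphaM p n1)
  * (coshq (qq p) 1 * A1c p - A2c p * lam p n1)%:C / (den p n1)%:C.

Definition coef_e (R : realType) (p : aw_data R) (n1 n2 : R) : R[i] :=
  ((tbcoef (qq p) n2 (alphaM p n1)
      * (coshq (qq p) 1 * A1c p - A2c p * lam p n1)
    + A0c p * (A1c p * lam p n1 + coshq (qq p) 1 * A2c p)) / den p n1)%:C.

Definition den_a (R : realType) (p : aw_data R) (n1 n2 : R) : R :=
  bL p (n1 - 1) (n2 - 1) - bL p n1 n2.
Definition den_c (R : realType) (p : aw_data R) (n1 n2 : R) : R :=
  bL p (n1 - 1) (n2 + 1) - bL p n1 n2.

Definition coef_a (R : realType) (p : aw_data R)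
    (ra rta : R -> R * R * R * R -> R[i]) (n1 n2 : R) : R[i] :=
  (aL p ra n1 n2 * coef_d p rta (n1 - 1) n2
   - aL p ra n1 (n2 - 1) * coef_d p rta n1 n2) / (den_a p n1 n2)%:C.

Definition coef_c (R : realType) (p : aw_data R)
    (ra rta : R -> R * R * R * R -> R[i]) (n1 n2 : R) : R[i] :=
  (aL p ra n1 n2 * coef_d p rta (n1 - 1) (n2 + 1)
   - aL p ra n1 (n2 + 1) * coef_d p rta n1 (n2 + 1)) / (den_c p n1 n2)%:C.

(* Every quotient coef_a, coef_c that multiplies a basis vector in the nine-term
   formula has a nonzero denominator.  This is a genuine restriction: for
   N1 = 0 < N2 these quotients are 0 / 0. *)
Definition coefs_defined (R : realType) (p : aw_data R) : Prop :=
  (forall n1 n2, range12 p n1 n2 -> range12 p (n1 - 1) (n2 - 1) ->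
     den_a p n1 n2 != 0) /\
  (forall n1 n2, range12 p n1 n2 -> range12 p (n1 - 1) (n2 + 1) ->
     den_c p n1 n2 != 0).

(* Main.v *)
(** Write [E i k] for the joint eigenbasis of [1 (x) K1] and [K2], [l] and [m] for the
lowering entries of [L1 (x) 1] and [M2] in it. The first of each pair of AW relations
multiplies the entries of the second generator by
[- (s - sinh_q(x + 2)) (s - sinh_q(x - 2))], so that [L1 (x) 1] and [M2] are tridiagonal
and [L2] is a nine-term operator whose diagonal blocks are affine in [M2] and [L1 (x) 1];
this gives the coefficients b, d, e. The diagonal entries of the second AW relations are
first-order recurrences for [|l|^2] and [|m|^2], solved by the functions a_n^2 and their
tilde versions. The corners a and c follow from [L1 L2 = L2 L1].

It remains to choose phases making all [l] and [m] real, which is possible if and only if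
[P Q^*] is real for every elementary square, where [P] and [Q] are the products of the
entries along its two paths. The relations [L1 L2 = L2 L1], [M2 L2 = L2 M2] and the second
AW relation of [M2] and [L1] are real linear equations for [P], [Q] and the corner of [L2].
If [P Q^*] is not real they are all proportional, for both diagonals of the square, and
this forces two values of [(A2 + i A1) / (cosh_q 1 + i s)] to agree up to sign. *)
Require Import Defs.
From HB Require Import structures.
From mathcomp Require Import all_boot all_order all_algebra.
From mathcomp Require Import sesquilinear complex.
From mathcomp Require Import boolp reals exp.
From mathcomp Require Import ring lra zify.

Set Implicit Arguments.
Unset Strict Implicit.
Unset Printing Implicit Defensive.

Import Order.TTheory GRing.Theory Num.Theory.
Local Open Scope ring_scope.
Local Open Scope complex_scope.

(** * q-hyperbolic functions *)

Section QHyperbolic.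
Variables (R : realType) (q : R).
Hypothesis hq : 0 < q < 1.

Lemma q_gt0 : 0 < q. Proof. by case/andP: hq. Qed.
Lemma q_neq0 : q != 0. Proof. by rewrite gt_eqF ?q_gt0. Qed.

Lemma pow_gt0 x : 0 < q `^ x.
Proof. by rewrite powR_gt0 ?q_gt0. Qed.

Lemma powD x y : q `^ (x + y) = q `^ x * q `^ y.
Proof. by rewrite powRD // q_neq0 implybT. Qed.

Lemma sinhqE x : sinhq q x = q `^ x - (q `^ x)^-1.
Proof. by rewrite /sinhq powRN. Qed.

Lemma coshqE x : coshq q x = q `^ x + (q `^ x)^-1.
Proof. by rewrite /coshq powRN. Qed.

Lemma pow1 : q `^ 1 = q. Proof. by rewrite powRr1 ?ltW ?q_gt0. Qed.

Lemma powN1 : q `^ (-1) = q^-1. Proof. by rewrite powRN pow1. Qed.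

Lemma pow_nat (n : nat) : q `^ n%:R = q ^+ n.
Proof. by rewrite powR_mulrn ?ltW ?q_gt0. Qed.

Lemma pow_natN (n : nat) : q `^ (- n%:R) = (q ^+ n)^-1.
Proof. by rewrite powRN pow_nat. Qed.

Lemma coshq_gt0 x : 0 < coshq q x.
Proof. by rewrite /coshq addr_gt0 ?pow_gt0. Qed.

Lemma coshq_neq0 x : coshq q x != 0.
Proof. by rewrite gt_eqF ?coshq_gt0. Qed.

Lemma sinhq_decr x y : x < y -> sinhq q y < sinhq q x.
Proof.
move=> xy; rewrite /sinhq.
have hp a b : a < b -> q `^ b < q `^ a.
  move=> ab; rewrite /powR (negbTE q_neq0) ltr_expR.
  by rewrite ltr_nM2r // ln_lt0.
have := hp _ _ xy; have : - y < - x by lra.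
by move/hp; lra.
Qed.

Lemma sinhq_inj : injective (sinhq q).
Proof.
move=> x y e; case: (ltrgtP x y) => // /sinhq_decr; rewrite e ltxx //.
Qed.

#[local] Opaque sinhq coshq.

Lemma sinhq_eq x y : (sinhq q x == sinhq q y) = (x == y).
Proof. exact: (inj_eq sinhq_inj). Qed.

Lemma sinhqN x : sinhq q (- x) = - sinhq q x.
Proof. by rewrite !sinhqE powRN invrK opprB. Qed.

Lemma sinhq1_neq0 : sinhq q 1 != 0.
Proof.
suff -> : 0 = sinhq q 0 by rewrite sinhq_eq oner_eq0.
by rewrite sinhqE powRr0 invr1 subrr.
Qed.

(* The quadratic form multiplying a matrix entry of [L] in the first AW relation:
   it factors, and this is what makes [L] tridiagonal. *)
Lemma sinhq_quadratic x y :
  coshq q 2 * sinhq q x * sinhq q y - sinhq q x ^+ 2 - sinhq q y ^+ 2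
    + coshq q 1 ^+ 2 * sinhq q 1 ^+ 2
  = - ((sinhq q y - sinhq q (x + 2)) * (sinhq q y - sinhq q (x - 2))).
Proof.
rewrite !sinhqE !coshqE !powD pow_natN pow1.
have := pow_gt0 x; have := pow_gt0 y; have := q_gt0.
by move: (q `^ x) (q `^ y) => X Y q0 Y0 X0; field; rewrite !gt_eqF.
Qed.

Lemma coshq_sq x :
  coshq q (x - 1) * coshq q (x + 1) = sinhq q x ^+ 2 + coshq q 1 ^+ 2.
Proof.
rewrite !sinhqE !coshqE !powD powN1 pow1.
have := pow_gt0 x; have := q_gt0.
by move: (q `^ x) => X q0 X0; field; rewrite !gt_eqF.
Qed.

Lemma coshq2 : coshq q 2 = sinhq q 1 ^+ 2 + 2.
Proof. by rewrite sinhqE coshqE pow1 (pow_nat 2); field; rewrite q_neq0. Qed.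

Lemma sinhq_step x : coshq q 2 * sinhq q x = sinhq q (x + 2) + sinhq q (x - 2).
Proof.
rewrite !sinhqE !coshqE !powD pow_natN !pow1.
have := pow_gt0 x; have := q_gt0.
by move: (q `^ x) => X q0 X0; field; rewrite !gt_eqF.
Qed.

Lemma sinhqDB x y : sinhq q (x + y) + sinhq q (x - y) = sinhq q x * coshq q y.
Proof.
rewrite !sinhqE !coshqE !powD powRN.
have := pow_gt0 x; have := pow_gt0 y.
by move: (q `^ x) (q `^ y) => X Y Y0 X0; field; rewrite !gt_eqF.
Qed.

Lemma sinhqMDB x y :
  sinhq q (x + y) * sinhq q (x - y) = sinhq q x ^+ 2 - coshq q y ^+ 2 + 4.
Proof.
rewrite !sinhqE !coshqE !powD powRN.
have := pow_gt0 x; have := pow_gt0 y.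
by move: (q `^ x) (q `^ y) => X Y Y0 X0; field; rewrite !gt_eqF.
Qed.

(** Common form of a_n^2 ([sg = 1]) and of its tilde version ([sg = -1]), with [z = 2n + b0]. The
    four linear factors are multiplied in pairs, so that besides [z] only the constants of b_n
    occur, which are those of the AW relations. *)
Definition aw_offdiag (sg z B0 B1 B2 B3 : R) : R :=
  let y := sinhq q (z - 1) in
  - ((y ^+ 2 - B0 * B3 * y + (B0 ^+ 2 - B3 ^+ 2 + 4))
     * (sg * (y ^+ 2 + 4) - B1 * B2 * y + (B1 ^+ 2 - B2 ^+ 2)))
  / (coshq q (z - 1) ^+ 2 * coshq q z * coshq q (z - 2)).

Lemma asqE n b0 b1 b2 b3 :
  asq q n (b0, b1, b2, b3)
  = aw_offdiag 1 (2 * n + b0) (sinhq q b0) (sinhq q b1) (coshq q b2) (coshq q b3).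
Proof.
rewrite /asq /aw_offdiag !big_cons big_nil mulr1; congr (- _ / _).
set y := sinhq q (_ - 1).
have roots a b : (y - sinhq q (a + b)) * (y - sinhq q (a - b)) =
    y ^+ 2 - sinhq q a * coshq q b * y + (sinhq q a ^+ 2 - coshq q b ^+ 2 + 4).
  by rewrite -sinhqDB -sinhqMDB; ring.
by rewrite mulrA !roots; ring.
Qed.

Lemma tasqE n b0 b1 b2 b3 :
  tasq q n (b0, b1, b2, b3)
  = aw_offdiag (-1) (2 * n + b0) (sinhq q b0) (coshq q b1) (sinhq q b2) (coshq q b3).
Proof.
rewrite /tasq asqE sinhqN /aw_offdiag; ring.
Qed.

(** Common form of b_n and its tilde version as a rational function of s = sinh_q(2n + b0); the
    denominator is that of [coshq_sq]. *)
Definition aw_diag (s B0 B1 B2 B3 : R) : R :=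
  ((B0 * B1 - B2 * B3) * s + coshq q 1 * (B1 * B3 + B0 * B2))
  / (s ^+ 2 + coshq q 1 ^+ 2).

Lemma bformE n b0 B0 B1 B2 B3 :
  bform q n b0 B0 B1 B2 B3 = aw_diag (sinhq q (2 * n + b0)) B0 B1 B2 B3.
Proof. by rewrite /bform /aw_diag (coshq_sq (2 * n + b0)). Qed.

(** Here [a], [b], [s], [c1] stand for sinh_q(z - 1), sinh_q(z + 1), sinh_q(z), cosh_q(1). The left
    side is antisymmetric in [a] and [b], hence [b - a] times a symmetric polynomial, which the two
    hypotheses express through [s] and [c1]. *)
Lemma aw_recurrence_poly (a b s c1 B0 B1 B2 B3 sg : R) :
  a + b = s * c1 -> a * b = s ^+ 2 - c1 ^+ 2 + 4 ->
  let N y := (y ^+ 2 - B0 * B3 * y + (B0 ^+ 2 - B3 ^+ 2 + 4))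
     * (sg * (y ^+ 2 + 4) - B1 * B2 * y + (B1 ^+ 2 - B2 ^+ 2)) in
  let P := s ^+ 2 + c1 ^+ 2 in
  let Bn := (B0 * B1 - B2 * B3) * s + c1 * (B1 * B3 + B0 * B2) in
  c1 * (N a * (b ^+ 2 + 4) - N b * (a ^+ 2 + 4))
  = (b - a) * ((B0 * B1 - B2 * B3) * Bn * P - s * Bn ^+ 2
     + P ^+ 2 * (c1 * (sg * (B0 * B3) + B1 * B2) - c1 ^+ 2 * sg * s)).
Proof.
move=> e1 e2 /=.
set F1 := B0 * B3; set F0 := B0 ^+ 2 - B3 ^+ 2 + 4.
set G1 := B1 * B2; set G0 := 4 * sg + (B1 ^+ 2 - B2 ^+ 2).
have -> : forall x, sg * (x ^+ 2 + 4) - G1 * x + (B1 ^+ 2 - B2 ^+ 2)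
    = sg * x ^+ 2 - G1 * x + G0 by move=> x; rewrite /G0; ring.
have -> : sg * (b ^+ 2 + 4) - G1 * b + (B1 ^+ 2 - B2 ^+ 2)
    = sg * b ^+ 2 - G1 * b + G0 by rewrite /G0; ring.
transitivity ((b - a) * (c1 * (F0 * G0 * (a + b) - (F0 * G1 + F1 * G0) * (a * b - 4)
   - 4 * (G0 + F1 * G1 + sg * F0) * (a + b)
   + (sg * F1 + G1) * ((a * b) ^+ 2 + 4 * ((a + b) ^+ 2 - a * b))
   - sg * (a + b) * ((a * b) ^+ 2 + 4 * ((a + b) ^+ 2 - 2 * (a * b)))))).
  ring.
congr (_ * _); rewrite e1 e2 /F0 /F1 /G0 /G1; ring.
Qed.

(** The closed forms satisfy the equation that [AW_entry2] extracts from the diagonal of the second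
    AW relation. *)
Lemma aw_recurrence sg z B0 B1 B2 B3 :
  let s := sinhq q z in
  let b := aw_diag s B0 B1 B2 B3 in
  let s2 := sinhq q 1 ^+ 2 in
  let c1 := coshq q 1 in
  (coshq q 2 * sinhq q (z - 2) - 2 * s) * aw_offdiag sg z B0 B1 B2 B3
  + (coshq q 2 * sinhq q (z + 2) - 2 * s) * aw_offdiag sg (z + 2) B0 B1 B2 B3
  + (coshq q 2 - 2) * s * b ^+ 2
  = s2 * (B0 * B1 - B2 * B3) * b - c1 ^+ 2 * (sg * s2) * s
    + c1 * (B0 * B3 * (sg * s2) + s2 * (B1 * B2)).
Proof.
rewrite /= /aw_offdiag /aw_diag.
have -> : z + 2 - 1 = z + 1 by ring.
have -> : z + 2 - 2 = z by ring.
(* The outer coefficients contain cosh_q(z - 2) and cosh_q(z + 2), which cancel against the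
   denominators of the two off-diagonal terms. *)
have [km kp] : coshq q 2 * sinhq q (z - 2) - 2 * sinhq q z
      = - (sinhq q 1 * coshq q 1 * coshq q (z - 2)) /\
    coshq q 2 * sinhq q (z + 2) - 2 * sinhq q z
      = sinhq q 1 * coshq q 1 * coshq q (z + 2).
  rewrite !sinhqE !coshqE !powD pow_natN !pow1.
  have := pow_gt0 z; have := q_gt0.
  by move: (q `^ z) => Z q0 Z0; split; field; rewrite !gt_eqF.
have e1 : sinhq q (z - 1) + sinhq q (z + 1) = sinhq q z * coshq q 1.
  by rewrite addrC sinhqDB.
have e2 : sinhq q (z - 1) * sinhq q (z + 1) = sinhq q z ^+ 2 - coshq q 1 ^+ 2 + 4.
  by rewrite mulrC sinhqMDB.
have e3 : sinhq q (z + 1) - sinhq q (z - 1) = coshq q z * sinhq q 1.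
  rewrite !sinhqE !coshqE !powD powN1 !pow1.
  have := pow_gt0 z; have := q_gt0.
  by move: (q `^ z) => Z q0 Z0; field; rewrite !gt_eqF.
have e4 w : coshq q w ^+ 2 = sinhq q w ^+ 2 + 4.
  rewrite sinhqE coshqE; have := pow_gt0 w.
  by move: (q `^ w) => Z Z0; field; rewrite !gt_eqF.
have := aw_recurrence_poly B0 B1 B2 B3 sg e1 e2.
rewrite /= e3 -!e4 -coshq_sq coshq2 addrK -coshq2 km kp.
have := coshq_neq0 (z - 1); have := coshq_neq0 (z + 1); have := coshq_neq0 z.
have := coshq_neq0 (z - 2); have := coshq_neq0 (z + 2); have := coshq_neq0 1.
move: (coshq q (z - 1)) (coshq q (z + 1)) (coshq q z) (coshq q (z - 2)) (coshq q (z + 2)).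
move: (coshq q 1) => c1 Dm Dp cz Cm Cp c10 Cp0 Cm0 cz0 Dp0 Dm0.
set Na := (X in c1 * (X * Dp ^+ 2 - _)).
set Nb := (X in c1 * (_ - X * Dm ^+ 2)).
rewrite -/Na -/Nb; clearbody Na Nb; move: (sinhq q 1) (sinhq q z) => s1 s key.
transitivity (s1 / (cz * (Dm * Dp) ^+ 2) * (c1 * (Na * Dp ^+ 2 - Nb * Dm ^+ 2))
   + s1 ^+ 2 * s * (((B0 * B1 - B2 * B3) * s + c1 * (B1 * B3 + B0 * B2)) / (Dm * Dp)) ^+ 2).
  by field; rewrite cz0 Dm0 Dp0 Cm0 Cp0.
by rewrite key; field; rewrite cz0 Dm0 Dp0.
Qed.

(** The coefficient equals sinh_q(z + 4) - sinh_q(z). Its being nonzero lets the recurrence be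
    solved for the upper neighbour. *)
Lemma aw_recurrence_coef z : coshq q 2 * sinhq q (z + 2) - 2 * sinhq q z != 0.
Proof.
rewrite sinhq_step addrK; apply/eqP => h.
have : sinhq q (z + 2 + 2) = sinhq q z by lra.
by move/sinhq_inj; lra.
Qed.
End QHyperbolic.

(** * Nondegeneracy of an elementary square *)

Section Plaquette.
Variable R : realType.

Section Nondegeneracy.
Variables c A1 A2 : R.

Definition rot_re (s : R) := (A1 * s + c * A2) / (s ^+ 2 + c ^+ 2).
Definition rot_im (s : R) := (c * A1 - A2 * s) / (s ^+ 2 + c ^+ 2).

Hypotheses (c_gt0 : 0 < c) (A2_gt0 : 0 < A2).

Lemma rot_den_gt0 s : 0 < s ^+ 2 + c ^+ 2.
Proof. by rewrite ltr_wpDl ?sqr_ge0 ?exprn_gt0. Qed.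

(* [rot_re s + i rot_im s] is [(A2 + i A1) / (c + i s)], which is injective in
   [s] even up to sign. *)
Lemma rot_inj s t e : e ^+ 2 = 1 ->
  rot_re t = e * rot_re s -> rot_im t = e * rot_im s -> t = s.
Proof.
have Ds := rot_den_gt0 s; have Dt := rot_den_gt0 t.
move=> e2 h1 h2.
(* Real and imaginary parts of (c + i s)(rot_re s + i rot_im s) = A2 + i A1, first at [t], then at
   [s]. *)
have k1 : c * rot_re t - t * rot_im t = A2.
  by rewrite /rot_re /rot_im; field; rewrite gt_eqF.
have k2 : t * rot_re t + c * rot_im t = A1.
  by rewrite /rot_re /rot_im; field; rewrite gt_eqF.
have k3 : c * rot_re s - s * rot_im s = A2.
  by rewrite /rot_re /rot_im; field; rewrite gt_eqF.
have k4 : s * rot_re s + c * rot_im s = A1.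
  by rewrite /rot_re /rot_im; field; rewrite gt_eqF.
move: k1 k2 k3 k4; rewrite h1 h2.
move: (rot_re s) (rot_im s) => f g k1 k2 k3 k4.
have := sqrf_eq1 e; rewrite e2 eqxx => /esym/orP[] /eqP ee; subst e.
  have /eqP : g * (t - s) = 0 by lra.
  rewrite mulf_eq0 => /orP[/eqP g0|/eqP]; last by lra.
  have /eqP : f * (t - s) = 0 by lra.
  rewrite mulf_eq0 => /orP[/eqP f0|/eqP]; last by lra.
  by move: k3 A2_gt0; rewrite f0 g0; lra.
(* For [e = -1] the four equations give a homogeneous linear system in [f], [g] whose determinant
   is, up to sign, (s + t)^2 + (2c)^2 > 0. So [f = g = 0], against [A2 > 0]. *)
have e3 : 2 * c * f = (s + t) * g by lra.
have e4 : 2 * c * g = - (s + t) * f by lra.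
have /eqP : f * ((s + t) ^+ 2 + (2 * c) ^+ 2) = 0.
  transitivity (2 * c * (2 * c * f) + (s + t) ^+ 2 * f); first ring.
  by rewrite e3; transitivity ((s + t) * (2 * c * g) + (s + t) ^+ 2 * f);
    [ring | rewrite e4; ring].
have D0 : 0 < (s + t) ^+ 2 + (2 * c) ^+ 2.
  by rewrite ltr_wpDl ?sqr_ge0 ?exprn_gt0 ?mulr_gt0.
rewrite mulf_eq0 (gt_eqF D0) orbF => /eqP f0.
have c20 : 2 * c != 0 by rewrite mulf_neq0 ?gt_eqF.
move/eqP: e4; rewrite f0 mulr0 mulf_eq0 (negbTE c20) /= => /eqP g0.
by move: k3 A2_gt0; rewrite f0 g0; lra.
Qed.

(* The four hypotheses say that the equations attached to the two diagonals of a square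
   are proportional. The first two give [g sx = +- g sX]; subtracting the other two then
   gives [f sx = +- f sX] with the same sign, against [rot_inj]. *)
Lemma plaquette_nondegenerate (A0 A3 N C sx sX sy sY : R) :
  0 < A3 -> 0 < C -> sx != sX -> sY < sy ->
  let f := rot_re in let g := rot_im in
  let h s := (A0 * s + c * A3) / (s ^+ 2 + c ^+ 2) in
  let b s t := t * f s + N * g s in
  let e1 u v := C * b sx u - b sX v - b sx v - (C - 2) * N * g sx in
  let e2 u v := C * b sX v - b sX u - b sx u in
  h sY * g sX = h sy * g sx -> h sy * g sX = h sY * g sx ->
  e1 sy sY * g sX + e2 sy sY * g sx = 0 ->
  e1 sY sy * g sX + e2 sY sy * g sx = 0 -> False.
Proof.
move=> A30 C0 xX yY f g h b e1 e2 h1 h2; rewrite /e1 /e2 /b => h3 h4.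
(* The numerator of [h] is affine; two distinct zeros would force [A0 = 0] and then [c * A3 = 0]. *)
have hh : (h sY, h sy) != (0, 0).
  apply/eqP => -[]; rewrite /h => /eqP.
  rewrite mulf_eq0 invr_eq0 (gt_eqF (rot_den_gt0 _)) orbF => /eqP a1 /eqP.
  rewrite mulf_eq0 invr_eq0 (gt_eqF (rot_den_gt0 _)) orbF => /eqP a2.
  have /eqP : A0 * (sy - sY) = 0 by lra.
  rewrite mulf_eq0 => /orP[/eqP a0|/eqP]; last by lra.
  by have := mulr_gt0 c_gt0 A30; move: a1; rewrite a0; lra.
have key : (g sX * f sx - g sx * f sX) * ((C + 1) * (sy - sY))
    + (g sX * f sX - g sx * f sx) * (sy - sY) = 0 by lra.
have {}key : (g sX * f sx - g sx * f sX) * (C + 1) + (g sX * f sX - g sx * f sx) = 0.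
  have yY' : sy - sY != 0 by rewrite subr_eq0 gt_eqF.
  by apply: (mulIf yY'); rewrite mul0r -key; ring.
(* Both values of [h] annihilate the difference of the squares of [g sx] and [g sX], and one of
   these values is nonzero. *)
have gg : g sx = g sX \/ g sx = - g sX.
  suff /eqP : (g sx - g sX) * (g sx + g sX) = 0.
    by rewrite mulf_eq0 subr_eq0 addr_eq0 => /orP[] /eqP; [left|right].
  have a1 : h sY * ((g sx - g sX) * (g sx + g sX)) = 0.
    have -> : h sY * ((g sx - g sX) * (g sx + g sX)) =
      (h sY * g sx) * g sx - (h sY * g sX) * g sX by ring.
    by rewrite -h2 h1; ring.
  have a2 : h sy * ((g sx - g sX) * (g sx + g sX)) = 0.
    have -> : h sy * ((g sx - g sX) * (g sx + g sX)) =
      (h sy * g sx) * g sx - (h sy * g sX) * g sX by ring.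
    by rewrite -h1 h2; ring.
  apply/eqP; apply: contraNT hh => gn0.
  move/eqP: a1; rewrite mulf_eq0 (negbTE gn0) orbF => /eqP->.
  by move/eqP: a2; rewrite mulf_eq0 (negbTE gn0) orbF => /eqP->.
(* Otherwise the affine numerator of [g] would vanish at the distinct points [sx] and [sX], although
   its slope is [- A2]. *)
have gX0 : g sX != 0.
  apply/eqP => g0; have gx0 : g sx = 0 by case: gg => ->; rewrite g0 ?oppr0.
  move/eqP: g0; move/eqP: gx0; rewrite /g /rot_im !mulf_eq0 !invr_eq0.
  rewrite !(gt_eqF (rot_den_gt0 _)) !orbF => /eqP a1 /eqP a2.
  have /eqP : A2 * (sx - sX) = 0 by lra.
  by rewrite mulf_eq0 subr_eq0 (negbTE xX) (gt_eqF A2_gt0).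
case: gg => ge; move: key; rewrite ge => key.
- have /eqP : g sX * (C * (f sx - f sX)) = 0 by lra.
  rewrite mulf_eq0 (negbTE gX0) mulf_eq0 (gt_eqF C0) /= subr_eq0 => /eqP fe.
  have := @rot_inj sX sx 1; rewrite expr1n !mul1r => /(_ erefl fe ge).
  by move/eqP: xX.
- have /eqP : g sX * ((C + 2) * (f sx + f sX)) = 0 by lra.
  rewrite mulf_eq0 (negbTE gX0) mulf_eq0 /= (addr_eq0 (f sx)) => /orP[/eqP|/eqP fe]; first lra.
  have := @rot_inj sX sx (-1); rewrite sqrrN expr1n !mulN1r => /(_ erefl fe ge).
  by move/eqP: xX.
Qed.
End Nondegeneracy.

(** Up to sign the imaginary part is the determinant of [P] and [Q] as vectors of the real plane, so
    the hypothesis is linear independence over the reals. *)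
Lemma real_combination_eq0 (P Q : R[i]) (x y : R) :
  x%:C * P + y%:C * Q = 0 -> complex.Im (P * Q^*) != 0 -> x = 0 /\ y = 0.
Proof.
case: P Q => [a b] [c d] /= /eqP; rewrite eq_complex /= => /andP[/eqP h1 /eqP h2] h3.
have k1 : x * (b * c - a * d) = 0.
  by transitivity (c * (x * b + 0 * a + (y * d + 0 * c))
       - d * (x * a - 0 * b + (y * c - 0 * d))); [ring | rewrite h1 h2; ring].
have k2 : y * (b * c - a * d) = 0.
  by transitivity (b * (x * a - 0 * b + (y * c - 0 * d))
       - a * (x * b + 0 * a + (y * d + 0 * c))); [ring | rewrite h1 h2; ring].
have h4 : b * c - a * d != 0.
  by apply: contraNneq h3 => h4; apply/eqP; lra.
by split; apply/eqP; [move/eqP: k1|move/eqP: k2]; rewrite mulf_eq0 (negbTE h4) orbF.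
Qed.

(** Eliminating the corner [a] leaves a real relation between [P] and [Q], whose two coefficients
    vanish by independence. Weighting them with [g] and [g'] removes [e0]. *)
Lemma plaquette_elim (a P Q : R[i]) (den g g' e0 e1 e2 : R) : den != 0 ->
  a * den%:C = g'%:C * P - g%:C * Q ->
  e0%:C * a + e1%:C * P + e2%:C * Q = 0 ->
  complex.Im (P * Q^*) != 0 -> e1 * g + e2 * g' = 0.
Proof.
move=> d0 h1 h2 hI.
have /real_combination_eq0 : (den * e1 + e0 * g')%:C * P
    + (den * e2 - e0 * g)%:C * Q = 0.
  rewrite !(rmorphD, rmorphB, rmorphM) /=.
  transitivity (den%:C * (e0%:C * a + e1%:C * P + e2%:C * Q)
     - e0%:C * (a * den%:C - (g'%:C * P - g%:C * Q))); first ring.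
  by rewrite h1 h2; ring.
case=> // k1 k2; apply: (mulfI d0).
by transitivity (g * (den * e1 + e0 * g') + g' * (den * e2 - e0 * g));
  [ring | rewrite k1 k2; ring].
Qed.
End Plaquette.

(** * Matrix entries of the AW relations *)

#[local] Opaque sinhq coshq.
Local Notation "f ** g" := (comp_lfun f g) (at level 40, left associativity).

Lemma conj_real (R : realType) (x : R) : (x%:C)^*%R = x%:C.
Proof. exact: conjc_real. Qed.

Lemma eq_of_subr (V : zmodType) (a b c d : V) : a - b = c - d -> c = d -> a = b.
Proof. by move=> e cd; apply/eqP; rewrite -subr_eq0 e cd subrr. Qed.

Section Forms.
Variables (R : realType) (W : vectType R[i]) (dot : {dot W for (@Num.conj R[i])}).
Implicit Types (u v w : W) (A K : 'End(W)).

Lemma dotDl u v w : dot (u + v) w = dot u w + dot v w.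
Proof. exact: linearDl. Qed.
Lemma dotDr u v w : dot w (u + v) = dot w u + dot w v.
Proof. exact: linearDr. Qed.
Lemma dotNl u v : dot (- u) v = - dot u v.
Proof. exact: linearNl. Qed.
Lemma dotNr u v : dot v (- u) = - dot v u.
Proof. exact: linearNr. Qed.
Lemma dotZl a u v : dot (a *: u) v = a * dot u v.
Proof. exact: linearZl_LR. Qed.
Lemma dotZr a u v : dot u (a *: v) = a^* * dot u v.
Proof. exact: linearZr_LR. Qed.
Lemma dot0l u : dot 0 u = 0. Proof. exact: linear0l. Qed.
Lemma dot0r u : dot u 0 = 0. Proof. exact: linear0r. Qed.
Lemma dotC u v : dot u v = (dot v u)^*%R.
Proof. by rewrite hermC mul1r. Qed.
Lemma dot_eq0 u : dot u u = 0 -> u = 0.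
Proof. by move/eqP; rewrite dnorm_eq0 => /eqP. Qed.

Lemma scalE (x : R) v : scal W x v = x%:C *: v.
Proof. by rewrite /scal scale_lfunE id_lfunE. Qed.


Lemma endD A u v : A (u + v) = A u + A v. Proof. exact: linearD. Qed.
Lemma endN A u : A (- u) = - A u. Proof. exact: linearN. Qed.
Lemma endZ A a u : A (a *: u) = a *: A u. Proof. exact: linearZ. Qed.

Definition endE := (add_lfunE, opp_lfunE, comp_lfunE, scalE, scale_lfunE, endD, endN, endZ).
Definition dotE := (dotDl, dotNl, dotZl, dotDr, dotNr, dotZr, conj_real).

Lemma eigen_orthogonal K A (a b : R) u v : self_adjoint dot K ->
  K ** A = A ** K ->
  K u = a%:C *: u -> K v = b%:C *: v -> a != b -> dot (A u) v = 0.
Proof.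
move=> saK KA Ku Kv ab.
have : dot (K (A u)) v = dot (A u) (K v) by rewrite saK.
have -> : K (A u) = A (K u) by rewrite -!comp_lfunE KA.
rewrite Ku Kv linearZ /= dotZl dotZr conj_real => /eqP.
rewrite -subr_eq0 -mulrBl -rmorphB mulf_eq0 fmorph_eq0 subr_eq0 (negbTE ab) /=.
by move/eqP.
Qed.

Variable q : R.
Hypothesis hq : 0 < q < 1.
Let s2 := sinhq q 1 ^+ 2.

(** Between eigenvectors of [K] each factor [K] next to [L] becomes a number, so the relation
    contains only one entry of [L], multiplied by the form of [sinhq_quadratic]; its constant term
    comes from the last structure parameter. *)
Lemma AW_entry1 K L A0 A1 A2 A3 A4 (x y : R) u v : self_adjoint dot K ->
  AW_rel q K L A0 A1 A2 A3 A4 (scal W s2) ->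
  K u = (sinhq q x)%:C *: u -> K v = (sinhq q y)%:C *: v ->
  (- ((sinhq q y - sinhq q (x + 2)) * (sinhq q y - sinhq q (x - 2))))%:C
    * dot (L u) v
  = s2%:C * ((sinhq q x)%:C * dot ((A0 ** A1 - A2 ** A3) u) v
             + (coshq q 1)%:C * dot ((A1 ** A3 + A0 ** A2) u) v).
Proof.
move=> saK [+ _]; rewrite -(sinhq_quadratic hq) /s2.
move: (sinhq q x) (sinhq q y) (coshq q 1) (coshq q 2) (sinhq q 1) => a b c c' s.
move=> /(congr1 (fun f : 'End(W) => dot (f u) v)) + Ku Kv.
rewrite !(endE, Ku, dotE, saK, Kv) => e.
rewrite !(rmorphD, rmorphB, rmorphN, rmorphM, rmorphXn) /=.
move: e; rewrite !rmorphXn /=.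
move: (dot (L u) v) (dot (A0 (A1 u)) v) (dot (A2 (A3 u)) v)
  (dot (A1 (A3 u)) v) (dot (A0 (A2 u)) v) => d1 d2 d3 d4 d5 e.
by apply: (eq_of_subr _ e); ring.
Qed.

(** On the diagonal only the squared moduli of the two neighbouring entries of [L] survive. The
    squared norms of [u'] and [u''] are kept because a neighbour beyond the end of a ladder is the
    zero vector. The sign [sg] is 1 for [L1] and -1 for [M2]. *)
Lemma AW_entry2 K L A0 A1 A2 A3 A5 (sg a a' a'' b B e03 e12 : R) (x y : R[i]) u u' u'' :
  self_adjoint dot K -> self_adjoint dot L ->
  AW_rel q K L A0 A1 A2 A3 (scal W (sg * s2)) A5 ->
  K u = a%:C *: u -> K u' = a'%:C *: u' -> K u'' = a''%:C *: u'' ->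
  L u = x *: u' + b%:C *: u + y *: u'' ->
  dot u u = 1 -> dot u u' = 0 -> dot u u'' = 0 -> dot u' u'' = 0 ->
  (forall w, dot ((A0 ** A1 - A2 ** A3) w) u = B%:C * dot w u) ->
  dot (A0 (A3 u)) u = e03%:C -> dot (A1 (A2 u)) u = e12%:C ->
  (coshq q 2 * a' - 2 * a)%:C * (x * x^* * dot u' u')
  + (coshq q 2 * a'' - 2 * a)%:C * (y * y^* * dot u'' u'')
  + ((coshq q 2 - 2) * a * b ^+ 2)%:C
  = (s2 * B * b - coshq q 1 ^+ 2 * (sg * s2) * a
     + coshq q 1 * (e03 * (sg * s2) + s2 * e12))%:C.
Proof.
move=> saK saL [_ +]; rewrite /s2.
move: (coshq q 1) (coshq q 2) (sinhq q 1) => c c' s.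
move=> /(congr1 (fun f : 'End(W) => dot (f u) u)) + Ku Ku' Ku'' Lu n1 o1 o2 o3 hB h03 h12.
have o1' : dot u' u = 0 by rewrite dotC o1 conjC0.
have o2' : dot u'' u = 0 by rewrite dotC o2 conjC0.
have o3' : dot u'' u' = 0 by rewrite dotC o3 conjC0.
move: (A0 ** A1 - A2 ** A3) hB => Bo hB.
rewrite !(add_lfunE, opp_lfunE, comp_lfunE, scalE, scale_lfunE) Ku !endZ !dotE.
rewrite hB h03 h12 n1 (saL (K (L u))) (saL (L u)) (saK (L (L u))) Ku dotZr conj_real.
rewrite (saL (L u)) Lu.
rewrite !(endE, Ku, Ku', Ku'', dotE, n1, o1, o2, o3, o1', o2', o3').
rewrite !(rmorphD, rmorphB, rmorphM, rmorphXn, rmorph_nat) /=.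
move: (dot u' u') (dot u'' u'') (x^*)%R (y^*)%R => n' n'' x' y' e.
by apply: (eq_of_subr _ e); ring.
Qed.
End Forms.

(** * Corner equations of an elementary square *)

Section PlaquetteEquations.
Variables (R : realType) (W : vectType R[i]) (dot : {dot W for (@Num.conj R[i])}).
Variables (E : int -> int -> W) (L M L2 : 'End(W)).
Variables (b be : int -> int -> R) (g h : int -> R).

Definition lowL i k := dot (L (E i k)) (E (i - 1) k).
Definition lowM i k := dot (M (E i k)) (E i (k - 1)).
Local Notation l := lowL.
Local Notation m := lowM.

Hypotheses (saL : self_adjoint dot L) (saM : self_adjoint dot M)
  (saL2 : self_adjoint dot L2).
Hypothesis E_orth : forall i k i' k',
  (i != i') || (k != k') -> dot (E i k) (E i' k') = 0.
Hypothesis E_unit : forall w i k,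
  dot w (E i k) * dot (E i k) (E i k) = dot w (E i k).
Hypothesis L_E : forall i k, L (E i k) =
  l i k *: E (i - 1) k + (b i k)%:C *: E i k + (l (i + 1) k)^*%R *: E (i + 1) k.
Hypothesis M_E : forall i k, M (E i k) =
  m i k *: E i (k - 1) + (be i k)%:C *: E i k + (m i (k + 1))^*%R *: E i (k + 1).
Hypothesis L2_far : forall i k i' k',
  (1 < `|i - i'|) || (1 < `|k - k'|) -> dot (L2 (E i k)) (E i' k') = 0.
Hypothesis L2_row : forall i k, dot (L2 (E i k)) (E (i - 1) k) = (h k)%:C * l i k.
Hypothesis L2_col : forall i k, dot (L2 (E i k)) (E i (k - 1)) = (g i)%:C * m i k.

Lemma L_row i k i' k' : k != k' -> dot (L (E i k)) (E i' k') = 0.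
Proof.
by move=> kk; rewrite L_E !dotE !E_orth ?kk ?orbT // !mulr0 !addr0.
Qed.

Lemma M_col i k i' k' : i != i' -> dot (M (E i k)) (E i' k') = 0.
Proof.
by move=> kk; rewrite M_E !dotE !E_orth ?kk ?orbT // !mulr0 !addr0.
Qed.

Lemma L_far i k i' k' : 1 < `|i - i'| -> dot (L (E i k)) (E i' k') = 0.
Proof.
move=> ii; rewrite L_E !dotE (@E_orth (i - 1) k i' k'); last by lia.
rewrite (@E_orth i k i' k') ?(@E_orth (i + 1) k i' k'); try by lia.
by rewrite !mulr0 !addr0.
Qed.

Lemma L_diag i k : dot (L (E i k)) (E i k) = (b i k)%:C * dot (E i k) (E i k).
Proof.
rewrite L_E !dotE (@E_orth (i - 1) k i k); last by lia.
rewrite (@E_orth (i + 1) k i k); last by lia.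
by rewrite !mulr0 addr0 add0r.
Qed.

Variables i k : int.
Let u := E i k.
Let v := E (i - 1) (k - 1).
Let a := dot (L2 u) v.
Let P := l i k * m (i - 1) k.
Let Q := l i (k - 1) * m i k.

Lemma L2_Lu : dot (L2 (L u)) v = (g (i - 1))%:C * P + (b i k)%:C * a.
Proof.
rewrite L_E !endE !dotE L2_col (@L2_far (i + 1)); last by lia.
by rewrite /P /a -/u -/v; ring.
Qed.

(** From (i, k) to (i - 1, k - 1) a product of [L] and [L2] goes either through the corner entry of
    [L2] and a diagonal entry of [L], or along one of the two sides of the square; the latter give
    [P] and [Q]. *)
Lemma plaquette_commLL2 : L ** L2 = L2 ** L ->
  a * (b (i - 1) (k - 1) - b i k)%:C = (g (i - 1))%:C * P - (g i)%:C * Q.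
Proof.
move=> /(congr1 (fun f : 'End(W) => dot (f u) v)); rewrite !comp_lfunE L2_Lu.
rewrite saL L_E !dotE conjCK subrK L2_col (@L2_far _ _ (i - 1 - 1)); last by lia.
rewrite -/a rmorphB /= /Q => e; apply: (eq_of_subr _ e); ring.
Qed.

Lemma plaquette_commML2 : M ** L2 = L2 ** M ->
  a * (be (i - 1) (k - 1) - be i k)%:C = (h (k - 1))%:C * Q - (h k)%:C * P.
Proof.
move=> /(congr1 (fun f : 'End(W) => dot (f u) v)); rewrite !comp_lfunE.
rewrite saM [M v]M_E [M u]M_E !endE !dotE conjCK subrK !L2_row.
rewrite (@L2_far _ _ _ (k - 1 - 1)); last by lia.
rewrite (@L2_far _ (k + 1)); last by lia.
rewrite -/u -/v -/a rmorphB /= /Q /P => e; apply: (eq_of_subr _ e); ring.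
Qed.

(** The vectors have norm one or are zero, so a squared norm may be dropped next to an entry that
    involves the same vector. *)
Lemma L_unitl j n : l j n * dot (E (j - 1) n) (E (j - 1) n) = l j n.
Proof. exact: E_unit. Qed.

Lemma L_unitr j n : l j n * dot (E j n) (E j n) = l j n.
Proof.
rewrite /l saL dotC [dot (E j n) (E j n)]dotC -rmorphM /=.
by rewrite E_unit.
Qed.

Lemma unit_cases (x n : R[i]) : x * n = x -> x = 0 \/ n = 1.
Proof.
move=> e; have /eqP : x * (n - 1) = 0 by rewrite mulrBr e mulr1 subrr.
by rewrite mulf_eq0 subr_eq0 => /orP[] /eqP; [left | right].
Qed.

Variables (q A1 N AN2 : R) (A5 : 'End(W)).
Let s2 := sinhq q 1 ^+ 2.

(** The third linear equation for [P], [Q] and the corner [a]. The corner enters through [- L2] in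
    the place of a structure parameter, the products [P] and [Q] through the paths of two steps of
    [L] and one of [M]. *)
Lemma plaquette_AW :
  AW_rel q M L (scal W AN2) (scal W A1) (- L2) (scal W N) (scal W s2) A5 ->
  (coshq q 2)%:C * (P * (b (i - 1) (k - 1))%:C + Q * (b i k)%:C)
  - Q * (b i (k - 1) + b (i - 1) (k - 1))%:C - P * (b i k + b (i - 1) k)%:C
  = (s2 * N)%:C * ((g (i - 1))%:C * P + (b i k)%:C * a)
    - (coshq q 1 * s2 * A1)%:C * a.
Proof.
move=> [_ /(congr1 (fun f : 'End(W) => dot (f u) v))].
rewrite !(add_lfunE, opp_lfunE, comp_lfunE, scalE, scale_lfunE) !dotE.
have -> : dot (L (M (L u))) v = P * (b (i - 1) (k - 1))%:C + Q * (b i k)%:C.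
  rewrite saL [L v]L_E [L u]L_E !endE !dotE subrK conjCK.
  have z1 x y := M_col x y (i := i - 1) (i' := i - 1 - 1).
  have z2 x y := M_col x y (i := i) (i' := i - 1 - 1).
  have z3 x y := M_col x y (i := i + 1) (i' := i - 1 - 1).
  have z4 x y := M_col x y (i := i) (i' := i - 1).
  have z5 x y := M_col x y (i := i + 1) (i' := i - 1).
  have z6 x y := M_col x y (i := i - 1) (i' := i).
  have z7 x y := M_col x y (i := i + 1) (i' := i).
  rewrite z1 ?z2 ?z3 ?z4 ?z5 ?z6 ?z7; try by lia.
  rewrite -/(m (i - 1) k) -/(m i k) /P /Q; ring.
have -> : dot (L (L (M u))) v = Q * (b i (k - 1) + b (i - 1) (k - 1))%:C.
  rewrite saL [M u]M_E !endE !dotE [L v]L_E !dotE conjCK subrK.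
  rewrite !(L_row _ _ (k := k)) ?(L_row _ _ (k := k + 1)); try by lia.
  rewrite L_diag -/(l i (k - 1)).
  rewrite (@L_far i _ (i - 1 - 1)); last by lia.
  by rewrite rmorphD /= /Q; case: (unit_cases (L_unitr i (k - 1))) => ->; ring.
have -> : dot (M (L (L u))) v = P * (b i k + b (i - 1) k)%:C.
  rewrite saM [M v]M_E [L u]L_E !endE !dotE conjCK subrK.
  have z1 x y := L_row x y (k := k) (k' := k - 1).
  have z2 x y := L_row x y (k := k) (k' := k - 1 - 1).
  rewrite !z1 ?z2; try by lia.
  rewrite L_diag -/(l i k) (@L_far (i + 1)); last by lia.
  by rewrite rmorphD /= /P; case: (unit_cases (L_unitl i k)) => ->; ring.
have -> : dot (L u) v = 0 by apply: L_row; lia.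
have -> : dot (M u) v = 0 by apply: M_col; lia.
have -> : dot u v = 0 by apply: E_orth; lia.
rewrite !endZ !dotE L2_Lu -/a.
move=> e; apply: (eq_of_subr _ e).
rewrite /s2; move: (coshq q 1) (coshq q 2) (sinhq q 1 ^+ 2) => c c' s.
rewrite !rmorphM /=; ring.
Qed.
End PlaquetteEquations.

(** * The double ladder *)

Section AWBlocks.
Variables (R : realType) (W : vectType R[i]) (dot : {dot W for (@Num.conj R[i])}).
Variable q : R.
Hypothesis hq : 0 < q < 1.
Variables (K L A0 A1 A2 A3 A4 : 'End(W)).
Hypothesis saK : self_adjoint dot K.
Hypothesis hAW : AW q K L A0 A1 A2 A3 A4 (scal W (sinhq q 1 ^+ 2)).

(** For equal eigenvalues the quadratic form is a nonzero multiple of sinh_q(x)^2 + cosh_q(1)^2,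
    which is positive. Hence the first AW relation expresses the compression of [L] to an eigenspace
    of [K] by the structure parameters. *)
Lemma AW_block (x : R) u v :
  K u = (sinhq q x)%:C *: u -> K v = (sinhq q x)%:C *: v ->
  (sinhq q x ^+ 2 + coshq q 1 ^+ 2)%:C * dot (L u) v
  = (sinhq q x)%:C * dot ((A0 ** A1 - A2 ** A3) u) v
    + (coshq q 1)%:C * dot ((A1 ** A3 + A0 ** A2) u) v.
Proof.
move=> Ku Kv; case: hAW => /(AW_entry1 hq saK)/(_ Ku Kv) + _ _.
have s0 : (sinhq q 1 ^+ 2)%:C != 0 :> R[i].
  by rewrite fmorph_eq0 expf_neq0 // sinhq1_neq0.
rewrite -(sinhq_quadratic hq) (coshq2 hq) => e; apply: (mulfI s0); rewrite -{}e.
move: (sinhq q x) (sinhq q 1) (coshq q 1) => a s c.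
rewrite mulrA -rmorphM; congr (_%:C * _); ring.
Qed.

Lemma commM (A B C : 'End(W)) : C ** A = A ** C -> C ** B = B ** C ->
  C ** (A ** B) = A ** B ** C.
Proof. by move=> h1 h2; rewrite comp_lfunA h1 -comp_lfunA h2 comp_lfunA. Qed.

(** The structure parameters commute with [K], so the right side of [AW_entry1] vanishes between
    different eigenvalues, while the quadratic form vanishes only at [y = x + 2] and [y = x - 2]. *)
Lemma AW_tridiag (x y : R) u v : y != x -> y != x + 2 -> y != x - 2 ->
  K u = (sinhq q x)%:C *: u -> K v = (sinhq q y)%:C *: v -> dot (L u) v = 0.
Proof.
move=> n0 n1 n2 Ku Kv; case: hAW => /(AW_entry1 hq saK)/(_ Ku Kv) + hK _.
have hc A : A \in [:: K; A0; A1; A2; A3; A4; scal W (sinhq q 1 ^+ 2)] ->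
  K ** A = A ** K by move=> hA; apply: hK => //; rewrite inE eqxx.
have [c0 c1 c2 c3] : [/\ K ** A0 = A0 ** K, K ** A1 = A1 ** K,
    K ** A2 = A2 ** K & K ** A3 = A3 ** K].
  by split; apply: hc; rewrite !inE eqxx ?orbT.
have xy : sinhq q x != sinhq q y by rewrite sinhq_eq // eq_sym.
have hB : K ** (A0 ** A1 - A2 ** A3) = (A0 ** A1 - A2 ** A3) ** K.
  by rewrite comp_lfunDr comp_lfunDl comp_lfunNr comp_lfunNl !commM.
have hC : K ** (A1 ** A3 + A0 ** A2) = (A1 ** A3 + A0 ** A2) ** K.
  by rewrite comp_lfunDr comp_lfunDl !commM.
rewrite (eigen_orthogonal saK hB Ku Kv xy) (eigen_orthogonal saK hC Ku Kv xy).
rewrite !mulr0 addr0 mulr0 => /eqP.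
rewrite mulf_eq0 fmorph_eq0 oppr_eq0 mulf_eq0 !subr_eq0 !sinhq_eq //.
by rewrite (negbTE n1) (negbTE n2) => /eqP.
Qed.
End AWBlocks.

Section DoubleLadder.
Variables (R : realType) (p : aw_data R).
Let q := qq p.
Hypothesis hq : 0 < q < 1.

(* [E i k] has indices [n1 = idx1 i] and [n2 = idx2 k]. *)
Definition idx1 (i : int) : R := i%:~R - (N1 p + N2 p)%:R / 2.
Definition idx2 (k : int) : R := k%:~R - (N2 p)%:R / 2.
Definition inrange (i k : int) : bool :=
  (0 <= k <= (N2 p)%:Z) && (k <= i <= k + (N1 p)%:Z).

Variables (V1 V2 W : vectType R[i]) (dotW : {dot W for (@Num.conj R[i])}).
Variables (tens : {bilinear V1 -> V2 -> W}) (T : aw2_ops V1 V2 W).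

(** These properties survive multiplication of each vector by a phase. Zero vectors outside the
    range let the ladder formulas hold at the ends without case distinction; orthogonality follows
    from the distinct joint eigenvalues. *)
Record adapted_basis (E : int -> int -> W) : Prop := AdaptedBasis {
  ab_out : forall i k, ~~ inrange i k -> E i k = 0;
  ab_norm : forall i k, inrange i k -> dotW (E i k) (E i k) = 1;
  ab_K1 : forall i k, xK1 T (E i k) = (lam p (idx2 k))%:C *: E i k;
  ab_K2 : forall i k, K2 T (E i k) = (lam p (idx1 i))%:C *: E i k;
  ab_total : forall w, (forall i k, dotW w (E i k) = 0) -> w = 0 }.

Hypothesis hT : is_AW2_rep p dotW tens T.
Variable E : int -> int -> W.
Hypothesis hE : adapted_basis E.
Local Notation dot := dotW.

Lemma idx1_eq i i' : (idx1 i == idx1 i') = (i == i').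
Proof. by rewrite /idx1 (inj_eq (addIr _)) eqr_int. Qed.
Lemma idx2_eq k k' : (idx2 k == idx2 k') = (k == k').
Proof. by rewrite /idx2 (inj_eq (addIr _)) eqr_int. Qed.

Lemma lam_eq x y : (lam p x == lam p y) = (x == y).
Proof.
rewrite /lam sinhq_eq // (inj_eq (addIr _)) (inj_eq (mulfI _)) //.
by rewrite pnatr_eq0.
Qed.

Lemma ab_orth i k i' k' : (i != i') || (k != k') -> dot (E i k) (E i' k') = 0.
Proof.
have idc (A : 'End(W)) : A ** \1%VF = \1%VF ** A by rewrite comp_lfun1r comp_lfun1l.
case/orP => ne; rewrite -[E i k]id_lfunE.
  apply: (eigen_orthogonal (rep_sa_K2 hT) (idc _) (ab_K2 hE _ _) (ab_K2 hE _ _)).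
  by rewrite lam_eq idx1_eq.
apply: (eigen_orthogonal (rep_sa_xK1 hT) (idc _) (ab_K1 hE _ _) (ab_K1 hE _ _)).
by rewrite lam_eq idx2_eq.
Qed.

Lemma ab_unit w i k : dot w (E i k) * dot (E i k) (E i k) = dot w (E i k).
Proof.
case: (boolP (inrange i k)) => h; first by rewrite (ab_norm hE h) mulr1.
by rewrite (ab_out hE h) !dot0r mulr0.
Qed.

Lemma ab_expand w (s : seq (int * int)) : uniq s ->
  (forall i k, (i, k) \notin s -> dot w (E i k) = 0) ->
  w = \sum_(x <- s) dot w (E x.1 x.2) *: E x.1 x.2.
Proof.
move=> us hs; apply/eqP; rewrite -subr_eq0; apply/eqP/(ab_total hE) => i k.
rewrite dotDl dotNl linear_sumlz /=.
under eq_bigr do rewrite dotZl.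
case: (boolP ((i, k) \in s)) => h.
  rewrite (bigD1_seq (i, k)) //= ab_unit big1 ?addr0 ?subrr //.
  move=> [i' k'] /= ne; rewrite ab_orth ?mulr0 //.
  by move: ne; rewrite xpair_eqE negb_and.
rewrite hs // big1_seq ?subrr // => -[i' k'] /= h'; rewrite ab_orth ?mulr0 //.
by rewrite -negb_and -xpair_eqE; apply: contraNneq h => <-.
Qed.
End DoubleLadder.

Lemma eq_div_realC (R : realType) (D x : R) (z w : R[i]) : D != 0 ->
  D%:C * z = x%:C * w -> z = (x / D)%:C * w.
Proof.
move=> D0 e; have D0' : D%:C != 0 :> R[i] by rewrite fmorph_eq0.
by apply: (mulfI D0'); rewrite e mulrA -rmorphM mulrC [D * _]mulrC divfK // mulrC.
Qed.

(** * Entries of the generators in the joint eigenbasis *)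

Section Entries.
Variables (R : realType) (p : aw_data R).
Let q := qq p.
Hypothesis hq : 0 < q < 1.
Variables (V1 V2 W : vectType R[i]) (dotW : {dot W for (@Num.conj R[i])}).
Variables (tens : {bilinear V1 -> V2 -> W}) (T : aw2_ops V1 V2 W).
Hypothesis hT : is_AW2_rep p dotW tens T.
Variable E : int -> int -> W.
Hypothesis hE : adapted_basis p dotW T E.
Local Notation dot := dotW.
Local Notation l := (lowL dotW E (L1x T)).
Local Notation m := (lowM dotW E (M2 T)).

Let c1 := coshq q 1.
Let la (i : int) : R := lam p (idx1 p i).
Let ka (k : int) : R := lam p (idx2 p k).

Lemma bL_E n1 n2 : bL p n1 n2
  = aw_diag q (lam p n1) (lam p n2) (A1c p) (A2c p) (ANc p (N1 p)).
Proof.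
rewrite /bL /bcoef /alphaL bformE // /lam.
have -> : 2 * (n1 - n2) + (al0 p + 2 * n2) = 2 * n1 + al0 p by ring.
by rewrite [al0 p + _]addrC.
Qed.

Lemma tb_E n1 n2 : tbcoef q n2 (alphaM p n1)
  = aw_diag q (lam p n2) (A0c p) (ANc p (N1 p)) (- lam p n1) (ANc p (N2 p)).
Proof.
rewrite /tbcoef /alphaM bformE // /lam.
have -> : - al0 p - 2 * n1 = - (2 * n1 + al0 p) by ring.
by rewrite sinhqN.
Qed.

Lemma den_E n : den p n = lam p n ^+ 2 + c1 ^+ 2.
Proof. exact: (coshq_sq hq). Qed.

Lemma D_neq0 (s : R) : s ^+ 2 + c1 ^+ 2 != 0.
Proof. by rewrite gt_eqF // rot_den_gt0 // coshq_gt0. Qed.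

Lemma idx1D i : idx1 p (i + 1) = idx1 p i + 1.
Proof. by rewrite /idx1 intrD; ring. Qed.
Lemma idx1B i : idx1 p (i - 1) = idx1 p i - 1.
Proof. by rewrite /idx1 intrB; ring. Qed.
Lemma idx2D i : idx2 p (i + 1) = idx2 p i + 1.
Proof. by rewrite /idx2 intrD; ring. Qed.
Lemma idx2B i : idx2 p (i - 1) = idx2 p i - 1.
Proof. by rewrite /idx2 intrB; ring. Qed.

Lemma far1 i i' : 1 < `|i - i'| -> let x := 2 * idx1 p i + al0 p in
  let y := 2 * idx1 p i' + al0 p in [/\ y != x, y != x + 2 & y != x - 2].
Proof.
move=> h x y; rewrite /x /y; split; apply/eqP => e.
- have /eqP : idx1 p i' = idx1 p i by lra. by rewrite idx1_eq; lia.
- have /eqP : idx1 p i' = idx1 p (i + 1) by rewrite idx1D; lra. by rewrite idx1_eq; lia.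
- have /eqP : idx1 p i' = idx1 p (i - 1) by rewrite idx1B; lra. by rewrite idx1_eq; lia.
Qed.

Lemma far2 k k' : 1 < `|k - k'| -> let x := 2 * idx2 p k + al0 p in
  let y := 2 * idx2 p k' + al0 p in [/\ y != x, y != x + 2 & y != x - 2].
Proof.
move=> h x y; rewrite /x /y; split; apply/eqP => e.
- have /eqP : idx2 p k' = idx2 p k by lra. by rewrite idx2_eq; lia.
- have /eqP : idx2 p k' = idx2 p (k + 1) by rewrite idx2D; lra. by rewrite idx2_eq; lia.
- have /eqP : idx2 p k' = idx2 p (k - 1) by rewrite idx2B; lra. by rewrite idx2_eq; lia.
Qed.

Lemma ab_unitv i k : dot (E i k) (E i k) *: E i k = E i k.
Proof.
case: (boolP (inrange p i k)) => h; first by rewrite (ab_norm hE h) scale1r.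
by rewrite (ab_out hE h) scaler0.
Qed.

Lemma L1_diag i k : dot (L1x T (E i k)) (E i k)
  = (bL p (idx1 p i) (idx2 p k))%:C * dot (E i k) (E i k).
Proof.
have := AW_block hq (rep_sa_K2 hT) (rep_K2L1 hT) (ab_K2 hE i k) (ab_K2 hE i k).
rewrite -[sinhq _ (2 * _ + _)]/(la i) !(endE, ab_K1 hE, dotE) -/(ka k) -/q -/c1 => e.
rewrite bL_E /aw_diag -/c1 -/(la i) -/(ka k); apply: eq_div_realC; first exact: D_neq0.
rewrite e; move: (la i) (ka k) (A1c p) (A2c p) (ANc p (N1 p)) c1.
move: (dot _ _) => n s t a b c d; rewrite !(rmorphD, rmorphB, rmorphM) /=; ring.
Qed.

Lemma M2_diag i k : dot (M2 T (E i k)) (E i k)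
  = (tbcoef q (idx2 p k) (alphaM p (idx1 p i)))%:C * dot (E i k) (E i k).
Proof.
have := AW_block hq (rep_sa_xK1 hT) (rep_K1M2 hT) (ab_K1 hE i k) (ab_K1 hE i k).
rewrite -[sinhq _ (2 * _ + _)]/(ka k) !(endE, ab_K2 hE, dotE) -/(la i) -/q -/c1 => e.
rewrite tb_E /aw_diag -/c1 -/(la i) -/(ka k); apply: eq_div_realC; first exact: D_neq0.
rewrite e; move: (la i) (ka k) (A0c p) (ANc p (N2 p)) (ANc p (N1 p)) c1.
move: (dot _ _) => n s t a b c d; rewrite !(rmorphD, rmorphB, rmorphN, rmorphM) /=; ring.
Qed.

Lemma L1_comm : xK1 T ** L1x T = L1x T ** xK1 T.
Proof. by case: (rep_K2L1 hT) => _ _ h; apply: h; rewrite !inE eqxx ?orbT. Qed.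
Lemma M2_commK2 : K2 T ** M2 T = M2 T ** K2 T.
Proof. by case: (rep_K2L2 hT) => _ h _; apply: h; rewrite !inE eqxx ?orbT. Qed.
Lemma M2_commL2 : M2 T ** L2 T = L2 T ** M2 T.
Proof. by case: (rep_K2L2 hT) => _ _ h; apply: h; rewrite !inE eqxx ?orbT. Qed.
Lemma L1_commL2 : L1x T ** L2 T = L2 T ** L1x T.
Proof. by case: (rep_K1L2 hT) => _ _ h; apply: h; rewrite !inE eqxx ?orbT. Qed.

Lemma L1_eq0 i k i' k' : (k != k') || (1 < `|i - i'|) ->
  dot (L1x T (E i k)) (E i' k') = 0.
Proof.
case/orP => h.
  apply: (eigen_orthogonal (rep_sa_xK1 hT) L1_comm (ab_K1 hE _ _) (ab_K1 hE _ _)).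
  by rewrite lam_eq // idx2_eq.
have [h0 h1 h2] := far1 h.
exact: (AW_tridiag hq (rep_sa_K2 hT) (rep_K2L1 hT) h0 h1 h2 (ab_K2 hE i k) (ab_K2 hE i' k')).
Qed.

Lemma M2_eq0 i k i' k' : (i != i') || (1 < `|k - k'|) ->
  dot (M2 T (E i k)) (E i' k') = 0.
Proof.
case/orP => h.
  apply: (eigen_orthogonal (rep_sa_K2 hT) M2_commK2 (ab_K2 hE _ _) (ab_K2 hE _ _)).
  by rewrite lam_eq // idx1_eq.
have [h0 h1 h2] := far2 h.
exact: (AW_tridiag hq (rep_sa_xK1 hT) (rep_K1M2 hT) h0 h1 h2 (ab_K1 hE i k) (ab_K1 hE i' k')).
Qed.

Lemma L2_eq0 i k i' k' : (1 < `|i - i'|) || (1 < `|k - k'|) ->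
  dot (L2 T (E i k)) (E i' k') = 0.
Proof.
case/orP => h.
  have [h0 h1 h2] := far1 h.
  exact: (AW_tridiag hq (rep_sa_K2 hT) (rep_K2L2 hT) h0 h1 h2 (ab_K2 hE i k) (ab_K2 hE i' k')).
have [h0 h1 h2] := far2 h.
exact: (AW_tridiag hq (rep_sa_xK1 hT) (rep_K1L2 hT) h0 h1 h2 (ab_K1 hE i k) (ab_K1 hE i' k')).
Qed.

Lemma L1_E i k : L1x T (E i k) = l i k *: E (i - 1) k
  + (bL p (idx1 p i) (idx2 p k))%:C *: E i k + (l (i + 1) k)^*%R *: E (i + 1) k.
Proof.
rewrite [LHS](ab_expand hq hT hE (s := [:: (i - 1, k); (i, k); (i + 1, k)])).
- rewrite !big_cons big_nil /= addr0 L1_diag -scalerA ab_unitv.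
  by rewrite /lowL (rep_sa_L1x hT (E (i + 1) k)) -dotC addrK addrA.
- by rewrite /= !inE !xpair_eqE; lia.
- by move=> i' k'; rewrite !inE !xpair_eqE => h; apply: L1_eq0; lia.
Qed.

Lemma M2_E i k : M2 T (E i k) = m i k *: E i (k - 1)
  + (tbcoef q (idx2 p k) (alphaM p (idx1 p i)))%:C *: E i k
  + (m i (k + 1))^*%R *: E i (k + 1).
Proof.
rewrite [LHS](ab_expand hq hT hE (s := [:: (i, k - 1); (i, k); (i, k + 1)])).
- rewrite !big_cons big_nil /= addr0 M2_diag -scalerA ab_unitv.
  by rewrite /lowM (rep_sa_M2 hT (E i (k + 1))) -dotC addrK addrA.
- by rewrite /= !inE !xpair_eqE; lia.
- by move=> i' k'; rewrite !inE !xpair_eqE => h; apply: M2_eq0; lia.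
Qed.

(** By [AW_block], off-diagonal entries of [L2] at fixed [i] are [col_ratio i] times those of [M2],
    and at fixed [k] they are [row_ratio k] times those of [L1 (x) 1]. These are the rational
    factors of the coefficients d and b. *)
Definition col_ratio (i : int) : R := rot_im c1 (A1c p) (A2c p) (la i).
Definition row_ratio (k : int) : R :=
  (A0c p * ka k + c1 * ANc p (N2 p)) / (ka k ^+ 2 + c1 ^+ 2).

Lemma L2_row i k i' : i != i' -> dot (L2 T (E i k)) (E i' k)
  = (row_ratio k)%:C * dot (L1x T (E i k)) (E i' k).
Proof.
move=> ii; have := AW_block hq (rep_sa_xK1 hT) (rep_K1L2 hT) (ab_K1 hE i k) (ab_K1 hE i' k).
have o : dot (E i k) (E i' k) = 0 by apply: (ab_orth hq hT hE); rewrite ii.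
rewrite -[sinhq _ (2 * _ + _)]/(ka k) !(endE, dotE, o) -/q -/c1 => e.
apply: eq_div_realC; first exact: D_neq0.
rewrite e; move: (ka k) (A0c p) (A2c p) (ANc p (N2 p)) c1.
move: (dot _ _) => n s t a b d; rewrite !(rmorphD, rmorphB, rmorphM) /=; ring.
Qed.

Lemma L2_col i k k' : k != k' -> dot (L2 T (E i k)) (E i k')
  = (col_ratio i)%:C * dot (M2 T (E i k)) (E i k').
Proof.
move=> ii; have := AW_block hq (rep_sa_K2 hT) (rep_K2L2 hT) (ab_K2 hE i k) (ab_K2 hE i k').
have o : dot (E i k) (E i k') = 0 by apply: (ab_orth hq hT hE); rewrite ii orbT.
rewrite -[sinhq _ (2 * _ + _)]/(la i) !(endE, dotE, o) -/q -/c1 => e.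
apply: eq_div_realC; first exact: D_neq0.
rewrite e; move: (la i) (A0c p) (A1c p) (A2c p) c1.
move: (dot _ _) => n s t a b d; rewrite !(rmorphD, rmorphB, rmorphM) /=; ring.
Qed.

Lemma L2_diag i k : dot (L2 T (E i k)) (E i k)
  = coef_e p (idx1 p i) (idx2 p k) * dot (E i k) (E i k).
Proof.
have := AW_block hq (rep_sa_K2 hT) (rep_K2L2 hT) (ab_K2 hE i k) (ab_K2 hE i k).
rewrite -[sinhq _ (2 * _ + _)]/(la i) !(endE, dotE, M2_diag) -/q -/c1 => e.
rewrite /coef_e den_E; apply: eq_div_realC; first exact: D_neq0.
rewrite e -/q -/c1 -/(la i); move: (la i) (A0c p) (A1c p) (A2c p) c1 (tbcoef _ _ _).
move: (dot _ _) => n s t a b d x; rewrite !(rmorphD, rmorphB, rmorphM) /=; ring.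
Qed.
End Entries.

(** * Zeros of the off-diagonal functions and moduli of the lowering entries *)

Section Zeros.
Variables (R : realType) (q : R).
Hypothesis hq : 0 < q < 1.

Lemma asq_eq0 n b0 b1 b2 b3 : let y := 2 * n + b0 - 1 in
  (asq q n (b0, b1, b2, b3) == 0)
  = [|| y == b0 + b3, y == b0 - b3, y == b1 + b2 | y == b1 - b2].
Proof.
rewrite /= /asq !big_cons big_nil mulr1 mulf_eq0 oppr_eq0 invr_eq0.
rewrite !(mulf_eq0 (coshq _ _ ^+ 2 * _)) (mulf_eq0 (coshq _ _ ^+ 2)) sqrf_eq0.
rewrite !(negbTE (coshq_neq0 hq _)) !orbF.
by rewrite !(mulf_eq0 (sinhq _ _ - _)) !subr_eq0 !(sinhq_eq hq).
Qed.

Lemma tasq_eq0 n b0 b1 b2 b3 : let y := 2 * n + b0 - 1 in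
  (tasq q n (b0, b1, b2, b3) == 0)
  = [|| y == b0 + b3, y == b0 - b3, y == - b2 + b1 | y == - b2 - b1].
Proof. by rewrite /= /tasq oppr_eq0 asq_eq0. Qed.

(** The closed forms satisfy the same equation by [aw_recurrence], and the coefficient of [Y] is
    nonzero. *)
Lemma ladder_step sg z B0 B1 B2 B3 (X Y : R[i]) :
  let s := sinhq q z in
  let b := aw_diag q s B0 B1 B2 B3 in
  let s2 := sinhq q 1 ^+ 2 in
  X = (aw_offdiag q sg z B0 B1 B2 B3)%:C ->
  (coshq q 2 * sinhq q (z - 2) - 2 * s)%:C * X
  + (coshq q 2 * sinhq q (z + 2) - 2 * s)%:C * Y + ((coshq q 2 - 2) * s * b ^+ 2)%:C
  = (s2 * (B0 * B1 - B2 * B3) * b - coshq q 1 ^+ 2 * (sg * s2) * s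
    + coshq q 1 * (B0 * B3 * (sg * s2) + s2 * (B1 * B2)))%:C ->
  Y = (aw_offdiag q sg (z + 2) B0 B1 B2 B3)%:C.
Proof.
move=> s b s2 ->; rewrite -(aw_recurrence hq) -/s -/b.
have := aw_recurrence_coef hq z; rewrite -/s.
move: (coshq q 2 * sinhq q (z + 2) - 2 * s) => x x0.
rewrite [in X in _ = X -> _]rmorphD [in X in _ = X -> _]rmorphD => /addIr.
rewrite !rmorphM => /addrI e; apply: (mulfI _ e).
by rewrite fmorph_eq0.
Qed.
End Zeros.

Section Moduli.
Variables (R : realType) (p : aw_data R).
Let q := qq p.
Hypothesis hq : 0 < q < 1.
Variables (V1 V2 W : vectType R[i]) (dotW : {dot W for (@Num.conj R[i])}).
Variables (tens : {bilinear V1 -> V2 -> W}) (T : aw2_ops V1 V2 W).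
Hypothesis hT : is_AW2_rep p dotW tens T.
Variable E : int -> int -> W.
Hypothesis hE : adapted_basis p dotW T E.
Local Notation dot := dotW.
Local Notation l := (lowL dotW E (L1x T)).
Local Notation m := (lowM dotW E (M2 T)).
Let la (i : int) : R := lam p (idx1 p i).
Let ka (k : int) : R := lam p (idx2 p k).

Definition sqL (i k : int) : R := asq q (idx1 p i - idx2 p k) (alphaL p (idx2 p k)).
Definition sqM (i k : int) : R := tasq q (idx2 p k) (alphaM p (idx1 p i)).

Lemma sqL_E i k : sqL i k = aw_offdiag q 1 (2 * idx1 p i + al0 p) (ka k)
  (A1c p) (A2c p) (ANc p (N1 p)).
Proof.
rewrite /sqL /alphaL asqE // /ka /lam.
have -> : 2 * (idx1 p i - idx2 p k) + (al0 p + 2 * idx2 p k) = 2 * idx1 p i + al0 p by ring.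
by rewrite [al0 p + _]addrC.
Qed.

Lemma sqM_E i k : sqM i k = aw_offdiag q (-1) (2 * idx2 p k + al0 p) (A0c p)
  (ANc p (N1 p)) (- la i) (ANc p (N2 p)).
Proof.
rewrite /sqM /alphaM tasqE // /la /lam; have -> : - al0 p - 2 * idx1 p i =
  - (2 * idx1 p i + al0 p) by ring.
by rewrite sinhqN.
Qed.

Lemma idx_eq (x : R) (a b : int) : x = 2 * (a%:~R - b%:~R) -> (x == 0) = (a == b).
Proof. by move=> ->; rewrite mulf_eq0 pnatr_eq0 /= subr_eq0 eqr_int. Qed.

(** The first two zeros are the bottom of a ladder and the place just above its top. The other two
    depend on [i] alone and may fall inside the range. *)
Lemma sqL_eq0 i k : (sqL i k == 0) = [|| i == k, i == k + (N1 p).+1%:Z,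
  2 * idx1 p i + al0 p - 1 == al1 p + al2 p | 2 * idx1 p i + al0 p - 1 == al1 p - al2 p].
Proof.
rewrite /sqL /alphaL asq_eq0 //.
have -> : 2 * (idx1 p i - idx2 p k) + (al0 p + 2 * idx2 p k) = 2 * idx1 p i + al0 p by ring.
congr [|| _, _ | _]; rewrite -subr_eq0; apply: idx_eq.
  by rewrite /idx1 /idx2 natrD; field.
by rewrite /idx1 /idx2 intrD natrD -pmulrn -natr1; field.
Qed.

(** All four zeros lie at the ends of the ladder with [i] fixed or outside it, so that the entries
    of [M2] inside do not vanish. *)
Lemma sqM_eq0 i k : (sqM i k == 0) =
  [|| k == 0, k == (N2 p).+1%:Z, k == i - (N1 p)%:Z | k == i + 1].
Proof.
rewrite /sqM /alphaM tasq_eq0 //; congr [|| _, _, _ | _]; rewrite -subr_eq0; apply: idx_eq.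
- by rewrite /idx2; field.
- by rewrite /idx2 -pmulrn -natr1; field.
- by rewrite /idx1 /idx2 intrB natrD -pmulrn; field.
- by rewrite /idx1 /idx2 intrD natrD; field.
Qed.

Lemma l_unitl i k : l i k * dot (E (i - 1) k) (E (i - 1) k) = l i k.
Proof. exact: ab_unit hE _ _ _. Qed.

Lemma l_unitr i k : l i k * dot (E i k) (E i k) = l i k.
Proof. exact: L_unitr (rep_sa_L1x hT) (ab_unit hE) i k. Qed.

Lemma m_unitl i k : m i k * dot (E i (k - 1)) (E i (k - 1)) = m i k.
Proof. exact: ab_unit hE _ _ _. Qed.

Lemma m_unitr i k : m i k * dot (E i k) (E i k) = m i k.
Proof.
rewrite /lowM (rep_sa_M2 hT) dotC [dot (E i k) (E i k)]dotC -rmorphM /=.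
by rewrite (ab_unit hE).
Qed.

Lemma l_out i k : ~~ (inrange p i k && inrange p (i - 1) k) -> l i k = 0.
Proof.
rewrite negb_and => /orP[] /(ab_out hE) e.
  by rewrite -l_unitr e dot0l mulr0.
by rewrite -l_unitl e dot0l mulr0.
Qed.

Lemma m_out i k : ~~ (inrange p i k && inrange p i (k - 1)) -> m i k = 0.
Proof.
rewrite negb_and => /orP[] /(ab_out hE) e.
  by rewrite -m_unitr e dot0l mulr0.
by rewrite -m_unitl e dot0l mulr0.
Qed.

Lemma sqL_step i k : inrange p i k -> l i k * (l i k)^* = (sqL i k)%:C ->
  l (i + 1) k * (l (i + 1) k)^* = (sqL (i + 1) k)%:C.
Proof.
move=> hik IH.
have hAW : AW_rel q (K2 T) (L1x T) (xK1 T) (scal W (A1c p)) (scal W (A2c p))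
    (scal W (ANc p (N1 p))) (scal W (1 * sinhq q 1 ^+ 2)) (scal W (sigc p)).
  by rewrite mul1r; case: (rep_K2L1 hT).
have o1 : dot (E i k) (E (i - 1) k) = 0 by apply: (ab_orth hq hT hE); lia.
have o2 : dot (E i k) (E (i + 1) k) = 0 by apply: (ab_orth hq hT hE); lia.
have o3 : dot (E (i - 1) k) (E (i + 1) k) = 0 by apply: (ab_orth hq hT hE); lia.
have hB w : dot ((xK1 T ** scal W (A1c p) - scal W (A2c p) ** scal W (ANc p (N1 p))) w)
    (E i k) = (ka k * A1c p - A2c p * ANc p (N1 p))%:C * dot w (E i k).
  rewrite !(endE, dotE, rep_sa_xK1 hT, ab_K1 hE) -/(ka k).
  move: (dot w (E i k)) => n; rewrite !(rmorphB, rmorphM) /=; ring.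
have h03 : dot (xK1 T (scal W (ANc p (N1 p)) (E i k))) (E i k) = (ka k * ANc p (N1 p))%:C.
  rewrite !(endE, dotE, ab_K1 hE) (ab_norm hE hik) -/(ka k) !rmorphM /=; ring.
have h12 : dot (scal W (A1c p) (scal W (A2c p) (E i k))) (E i k) = (A1c p * A2c p)%:C.
  rewrite !(endE, dotE) (ab_norm hE hik) !rmorphM /=; ring.
have := AW_entry2 (rep_sa_K2 hT) (rep_sa_L1x hT) hAW (ab_K2 hE i k)
  (ab_K2 hE (i - 1) k) (ab_K2 hE (i + 1) k) (L1_E hq hT hE i k) (ab_norm hE hik)
  o1 o2 o3 hB h03 h12.
have -> : l i k * (l i k)^* * dot (E (i - 1) k) (E (i - 1) k) = l i k * (l i k)^*.
  by rewrite mulrAC l_unitl.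
have -> : (l (i + 1) k)^* * ((l (i + 1) k)^*)^* * dot (E (i + 1) k) (E (i + 1) k)
    = l (i + 1) k * (l (i + 1) k)^*.
  by rewrite conjCK -mulrA l_unitr mulrC.
rewrite bL_E // sqL_E idx1D.
have -> : 2 * (idx1 p i + 1) + al0 p = 2 * idx1 p i + al0 p + 2 by ring.
move=> e; apply: (ladder_step hq (X := l i k * (l i k)^*%R)); first by rewrite IH sqL_E.
move: e; rewrite idx1B /lam -/q.
have -> : 2 * (idx1 p i - 1) + al0 p = 2 * idx1 p i + al0 p - 2 by ring.
by have -> : 2 * (idx1 p i + 1) + al0 p = 2 * idx1 p i + al0 p + 2 by ring.
Qed.

Lemma sqM_step i k : inrange p i k -> m i k * (m i k)^* = (sqM i k)%:C ->
  m i (k + 1) * (m i (k + 1))^* = (sqM i (k + 1))%:C.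
Proof.
move=> hik IH.
have hAW : AW_rel q (xK1 T) (M2 T) (scal W (A0c p)) (scal W (ANc p (N1 p))) (- K2 T)
    (scal W (ANc p (N2 p))) (scal W (-1 * sinhq q 1 ^+ 2)) (scal W (sigc p)).
  by rewrite mulN1r; case: (rep_K1M2 hT).
have o1 : dot (E i k) (E i (k - 1)) = 0 by apply: (ab_orth hq hT hE); lia.
have o2 : dot (E i k) (E i (k + 1)) = 0 by apply: (ab_orth hq hT hE); lia.
have o3 : dot (E i (k - 1)) (E i (k + 1)) = 0 by apply: (ab_orth hq hT hE); lia.
have hB w : dot ((scal W (A0c p) ** scal W (ANc p (N1 p)) - - K2 T ** scal W (ANc p (N2 p))) w)
    (E i k) = (A0c p * ANc p (N1 p) - - la i * ANc p (N2 p))%:C * dot w (E i k).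
  rewrite !(endE, dotE, rep_sa_K2 hT, ab_K2 hE) -/(la i).
  move: (dot w (E i k)) => n; rewrite !(rmorphB, rmorphN, rmorphM) /=; ring.
have h03 : dot (scal W (A0c p) (scal W (ANc p (N2 p)) (E i k))) (E i k)
    = (A0c p * ANc p (N2 p))%:C.
  rewrite !(endE, dotE) (ab_norm hE hik) !rmorphM /=; ring.
have h12 : dot (scal W (ANc p (N1 p)) ((- K2 T) (E i k))) (E i k)
    = (ANc p (N1 p) * - la i)%:C.
  rewrite !(endE, dotE, ab_K2 hE) (ab_norm hE hik) -/(la i) rmorphM rmorphN /=; ring.
have := AW_entry2 (rep_sa_xK1 hT) (rep_sa_M2 hT) hAW (ab_K1 hE i k)
  (ab_K1 hE i (k - 1)) (ab_K1 hE i (k + 1)) (M2_E hq hT hE i k) (ab_norm hE hik)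
  o1 o2 o3 hB h03 h12.
have -> : m i k * (m i k)^* * dot (E i (k - 1)) (E i (k - 1)) = m i k * (m i k)^*.
  by rewrite mulrAC m_unitl.
have -> : (m i (k + 1))^* * ((m i (k + 1))^*)^* * dot (E i (k + 1)) (E i (k + 1))
    = m i (k + 1) * (m i (k + 1))^*.
  by rewrite conjCK -mulrA m_unitr mulrC.
rewrite tb_E // sqM_E idx2D.
have -> : 2 * (idx2 p k + 1) + al0 p = 2 * idx2 p k + al0 p + 2 by ring.
move=> e; apply: (ladder_step hq (X := m i k * (m i k)^*%R)); first by rewrite IH sqM_E.
move: e; rewrite idx2B -/(la i) /lam -/q.
have -> : 2 * (idx2 p k - 1) + al0 p = 2 * idx2 p k + al0 p - 2 by ring.
by have -> : 2 * (idx2 p k + 1) + al0 p = 2 * idx2 p k + al0 p + 2 by ring.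
Qed.

(** Induction up the ladder from [i = k], where both sides are zero. Just above the top both sides
    vanish again; this case is needed because a and c evaluate the root there. *)
Lemma l_sq i k : inrange p i k || inrange p (i - 1) k -> l i k * (l i k)^* = (sqL i k)%:C.
Proof.
have H : forall n : nat, forall i k, i = k + n%:Z -> inrange p i k ->
    l i k * (l i k)^* = (sqL i k)%:C.
  elim=> [|n IH] {}i {}k e hik.
    rewrite l_out ?mul0r; last by rewrite e /inrange; lia.
    by apply/esym/eqP; rewrite fmorph_eq0 sqL_eq0; apply/orP; left; lia.
  have -> : i = (i - 1) + 1 by lia.
  have h : inrange p (i - 1) k by move: hik; rewrite /inrange; lia.
  by apply: sqL_step => //; apply: IH => //; lia.
case: (boolP (inrange p i k)) => /= h.
  by move=> _; apply: (H (`|i - k|%N)) => //; move: h; rewrite /inrange; lia.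
move=> h'; rewrite l_out ?(negbTE h) // mul0r; apply/esym/eqP.
rewrite fmorph_eq0 sqL_eq0; move: h h'; rewrite /inrange => h h'.
by apply/orP; right; apply/orP; left; lia.
Qed.

Lemma m_sq i k : inrange p i k || inrange p i (k - 1) -> m i k * (m i k)^* = (sqM i k)%:C.
Proof.
(* The ladder with [j] fixed starts at the larger of 0 and [j - N1], so its bottom is recognised by
   the position below being out of range. *)
have B j : forall k, inrange p j k -> ~~ inrange p j (k - 1) ->
    m j k * (m j k)^* = (sqM j k)%:C.
  move=> {}k h h'; rewrite m_out ?(negbTE h') ?andbF // mul0r; apply/esym/eqP.
  rewrite fmorph_eq0 sqM_eq0; move: h h'; rewrite /inrange; lia.
have H : forall n : nat, forall i k, k = n%:Z -> inrange p i k ->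
    m i k * (m i k)^* = (sqM i k)%:C.
  elim=> [|n IH] {}i {}k e hik; first by apply: B => //; rewrite e /inrange; lia.
  case: (boolP (inrange p i (k - 1))) => h; last exact: B.
  have -> : k = (k - 1) + 1 by lia.
  by apply: sqM_step => //; apply: IH => //; lia.
case: (boolP (inrange p i k)) => /= h.
  by move=> _; apply: (H (`|k|%N)) => //; move: h; rewrite /inrange; lia.
move=> h'; rewrite m_out ?(negbTE h) // mul0r; apply/esym/eqP.
rewrite fmorph_eq0 sqM_eq0; move: h h'; rewrite /inrange; lia.
Qed.

Lemma m_neq0 i k : inrange p i k -> inrange p i (k - 1) -> m i k != 0.
Proof.
move=> h h'; have := m_sq (i := i) (k := k); rewrite h => /(_ isT) e.
rewrite -mul_conjC_eq0 e fmorph_eq0 sqM_eq0.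
by move: h h'; rewrite /inrange; lia.
Qed.

Lemma l_eq0 i k k' : inrange p i k -> inrange p (i - 1) k ->
  inrange p i k' -> inrange p (i - 1) k' -> (l i k == 0) = (l i k' == 0).
Proof.
move=> h1 h2 h3 h4; rewrite -mul_conjC_eq0 -[RHS]mul_conjC_eq0.
rewrite !l_sq ?h1 ?h3 // !fmorph_eq0 !sqL_eq0.
move: h1 h2 h3 h4; rewrite /inrange => h1 h2 h3 h4.
have -> : (i == k) = false by lia.
have -> : (i == k') = false by lia.
have -> : (i == k + (N1 p).+1%:Z) = false by lia.
by have -> : (i == k' + (N1 p).+1%:Z) = false by lia.
Qed.
End Moduli.

(** * Phases *)

Section PlaquettePhases.
Variables (R : realType) (p : aw_data R).
Let q := qq p.
Hypothesis hq : 0 < q < 1.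
Variables (V1 V2 W : vectType R[i]) (dotW : {dot W for (@Num.conj R[i])}).
Variables (tens : {bilinear V1 -> V2 -> W}) (T : aw2_ops V1 V2 W).
Hypothesis hT : is_AW2_rep p dotW tens T.
Local Notation dot := dotW.

(** What the corner equations need, without the eigenvalues, whose order the reflection of [k] would
    reverse. [lf_col] allows any two positions since the reflection turns lowering into raising. *)
Record ladder_frame (E : int -> int -> W) (b be : int -> int -> R) (g h : int -> R)
    : Prop := LadderFrame {
  lf_orth : forall i k i' k', (i != i') || (k != k') -> dot (E i k) (E i' k') = 0;
  lf_unit : forall w i k, dot w (E i k) * dot (E i k) (E i k) = dot w (E i k);
  lf_L : forall i k, L1x T (E i k) = lowL dot E (L1x T) i k *: E (i - 1) k
    + (b i k)%:C *: E i k + (lowL dot E (L1x T) (i + 1) k)^*%R *: E (i + 1) k;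
  lf_M : forall i k, M2 T (E i k) = lowM dot E (M2 T) i k *: E i (k - 1)
    + (be i k)%:C *: E i k + (lowM dot E (M2 T) i (k + 1))^*%R *: E i (k + 1);
  lf_far : forall i k i' k', (1 < `|i - i'|) || (1 < `|k - k'|) ->
    dot (L2 T (E i k)) (E i' k') = 0;
  lf_row : forall i k, dot (L2 T (E i k)) (E (i - 1) k) = (h k)%:C * lowL dot E (L1x T) i k;
  lf_col : forall i k k', k != k' ->
    dot (L2 T (E i k)) (E i k') = (g i)%:C * dot (M2 T (E i k)) (E i k') }.

(* The antidiagonal of a square is the diagonal of its image under [k -> - k]. *)
Lemma frame_reflect E b be g h : ladder_frame E b be g h ->
  ladder_frame (fun i k => E i (- k)) (fun i k => b i (- k)) (fun i k => be i (- k))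
    g (fun k => h (- k)).
Proof.
clear hq; case=> h1 h2 h3 h4 h5 h6 h7; split.
- by move=> i k i' k' hk; apply: h1; lia.
- by move=> w i k; apply: h2.
- by move=> i k; rewrite [LHS]h3.
- move=> i k; rewrite [LHS]h4 /lowM.
  have -> : - (k - 1) = - k + 1 by lia.
  have -> : - (k + 1) = - k - 1 by lia.
  have -> : - (k + 1 - 1) = - k by lia.
  rewrite (rep_sa_M2 hT (E i (- k + 1))) -dotC addrK.
  rewrite [in RHS](rep_sa_M2 hT (E i (- k - 1))) -[in RHS]dotC.
  by rewrite addrC addrA addrAC.
- by move=> i k i' k' hk; apply: h5; lia.
- by move=> i k; apply: h6.
- by move=> i k k' hk; apply: h7; lia.
Qed.

Lemma frame_col E b be g h : ladder_frame E b be g h ->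
  forall i k, dot (L2 T (E i k)) (E i (k - 1)) = (g i)%:C * lowM dot E (M2 T) i k.
Proof. by clear hq; move=> hF i k; apply: (lf_col hF); lia. Qed.

Lemma frame_corner E b be g h (hF : ladder_frame E b be g h) i k :
  let l := lowL dot E (L1x T) in let m := lowM dot E (M2 T) in
  dot (L2 T (E i k)) (E (i - 1) (k - 1)) * (b (i - 1) (k - 1) - b i k)%:C
  = (g (i - 1))%:C * (l i k * m (i - 1) k) - (g i)%:C * (l i (k - 1) * m i k).
Proof.
exact: (plaquette_commLL2 (rep_sa_L1x hT) (lf_L hF) (lf_far hF) (frame_col hF)
  i k (L1_commL2 hT)).
Qed.

(** The equation from [L1] and [L2] is solved for the corner and substituted into the other two;
    [plaquette_elim] then gives one real condition from each. *)
Lemma frame_elim E b be g h (hF : ladder_frame E b be g h) i k :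
  let l := lowL dot E (L1x T) in let m := lowM dot E (M2 T) in
  let P := l i k * m (i - 1) k in let Q := l i (k - 1) * m i k in
  let C := coshq q 2 in
  b (i - 1) (k - 1) - b i k != 0 -> complex.Im (P * Q^*) != 0 ->
  h k * g i = h (k - 1) * g (i - 1) /\
  (C * b (i - 1) (k - 1) - b i k - b (i - 1) k - (C - 2) * ANc p (N1 p) * g (i - 1)) * g i
  + (C * b i k - b i (k - 1) - b (i - 1) (k - 1)) * g (i - 1) = 0.
Proof.
move=> l m P Q C hd hI.
have e1 := frame_corner hF i k; rewrite /= -/l -/m -/P -/Q in e1.
have e2 := plaquette_commML2 (rep_sa_M2 hT) (lf_M hF) (lf_far hF) (lf_row hF)
  i k (M2_commL2 hT).
have [hAW _ _] := rep_M2L1 hT.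
have e4 := plaquette_AW (rep_sa_L1x hT) (rep_sa_M2 hT) (lf_orth hF) (lf_unit hF)
  (lf_L hF) (lf_M hF) (lf_far hF) (frame_col hF) i k hAW.
rewrite -/l -/m -/P -/Q in e2 e4.
move: (dot _ _) e1 e2 e4 => a e1 e2 e4; split.
- have := @plaquette_elim _ a P Q _ (g i) (g (i - 1))
    (be (i - 1) (k - 1) - be i k) (h k) (- h (k - 1)) hd e1.
  rewrite mulNr => /(_ _ hI) H; apply/eqP; rewrite -subr_eq0; apply/eqP/H.
  by apply: (eq_of_subr _ e2); rewrite rmorphN /=; ring.
- apply: (@plaquette_elim _ a P Q _ (g i) (g (i - 1))
    (coshq q 1 * sinhq q 1 ^+ 2 * A1c p - (C - 2) * ANc p (N1 p) * b i k) _ _ hd e1) => //.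
  apply: (eq_of_subr _ e4); rewrite -/C; have -> : sinhq q 1 ^+ 2 = C - 2.
    by rewrite /C (coshq2 hq) addrK.
  move: (b _ _) (b _ _) (b _ _) (b _ _) (g (i - 1)) (coshq q 1) (A1c p) (ANc _ _) C.
  move=> *; rewrite !(rmorphB, rmorphD, rmorphM) /=; ring.
Qed.
End PlaquettePhases.

(** * Reality of the products around a square *)

Section SquarePhases.
Variables (R : realType) (p : aw_data R).
Let q := qq p.
Hypothesis hq : 0 < q < 1.
Variables (V1 V2 W : vectType R[i]) (dotW : {dot W for (@Num.conj R[i])}).
Variables (tens : {bilinear V1 -> V2 -> W}) (T : aw2_ops V1 V2 W).
Hypothesis hT : is_AW2_rep p dotW tens T.
Hypothesis hden : coefs_defined p.
Local Notation dot := dotW.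

Lemma range12_idx i k : inrange p i k -> range12 p (idx1 p i) (idx2 p k).
Proof.
clear hq hT hden; rewrite /inrange => h; split.
  exists `|k|%N; first by lia.
  by rewrite /idx2; have -> : `|k|%N%:R = k%:~R :> R by rewrite pmulrn; congr (_%:~R); lia.
exists `|i - k|%N; first by lia.
have -> : (`|i - k|%N)%:R = i%:~R - k%:~R :> R by rewrite pmulrn -intrB; congr (_%:~R); lia.
by rewrite /idx1 /idx2 natrD; field.
Qed.

Lemma idx_range12 n1 n2 : range12 p n1 n2 ->
  exists i k, [/\ inrange p i k, n1 = idx1 p i & n2 = idx2 p k].
Proof.
clear hq hT hden; move=> [[k hk ->] [j hj ->]]; exists (k%:Z + j%:Z), k%:Z; split=> //.
  by rewrite /inrange; lia.
by rewrite /idx1 intrD natrD -!pmulrn; field.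
Qed.

Lemma range12_idxP i k : range12 p (idx1 p i) (idx2 p k) -> inrange p i k.
Proof.
case/idx_range12 => i' [k' [h /eqP + /eqP]].
by rewrite idx1_eq idx2_eq => /eqP-> /eqP->.
Qed.

Lemma adapted_frame E : adapted_basis p dotW T E ->
  ladder_frame dotW T E (fun i k => bL p (idx1 p i) (idx2 p k))
    (fun i k => tbcoef q (idx2 p k) (alphaM p (idx1 p i)))
    (col_ratio p) (row_ratio p).
Proof.
move=> hE; split.
- exact: (ab_orth hq hT hE).
- exact: (ab_unit hE).
- exact: (L1_E hq hT hE).
- exact: (M2_E hq hT hE).
- exact: (L2_eq0 hq hT hE).
- by move=> i k; rewrite (L2_row hq hT hE); last by clear hden; lia.
- exact: (L2_col hq hT hE).
Qed.

(** Brings the diagonal entry to the shape of [b] in [plaquette_nondegenerate]. *)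
Lemma bL_rot i k : bL p (idx1 p i) (idx2 p k)
  = lam p (idx2 p k) * rot_re (coshq q 1) (A1c p) (A2c p) (lam p (idx1 p i))
    + ANc p (N1 p) * col_ratio p i.
Proof.
rewrite bL_E // /aw_diag /col_ratio /rot_re /rot_im -/q.
move: (lam p _) (lam p _) (A1c p) (A2c p) (ANc _ _) (coshq q 1) => s t a b n c; ring.
Qed.

Lemma plaquette_real E : adapted_basis p dotW T E -> forall i k,
  let l := lowL dotW E (L1x T) in let m := lowM dotW E (M2 T) in
  inrange p i k -> inrange p (i - 1) k -> inrange p i (k - 1) ->
  inrange p (i - 1) (k - 1) ->
  complex.Im (l i k * m (i - 1) k * (l i (k - 1) * m i k)^*) = 0.
Proof.
move=> hE i k l m h00 h10 h01 h11; apply/eqP/negPn/negP => hI.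
have hF := adapted_frame hE.
have := frame_elim hq hT hF (i := i) (k := k); rewrite -/l -/m /=.
rewrite idx1B idx2B => /(_ (hden.1 _ _ _ _)) H.
have {}H := H (range12_idx h00).
have h11' := range12_idx h11; rewrite idx1B idx2B in h11'.
have [a1 a2] := H h11' hI; clear H.
have hF' := frame_reflect hT hF.
(* With [1 - k] the reflected square has the same four vertices, and its diagonal is the
   antidiagonal of the original one. *)
have := frame_elim hq hT hF' (i := i) (k := 1 - k).
have -> : 1 - k - 1 = - k by lia.
have E1 : - (1 - k) = k - 1 by lia.
rewrite opprK E1 idx1B idx2B /=.
have h10' := range12_idx h10; rewrite idx1B in h10'.
have h01' := range12_idx h01; rewrite idx2B in h01'.
have := hden.2 _ _ h01'; rewrite /den_c subrK => /(_ h10') hd /(_ hd).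
(* Reflection replaces the entries of [M2] by their conjugates and exchanges the two entries of
   [L1], so the product in question is the conjugate of the original one. *)
have hI' : complex.Im (lowL dot (fun i k => E i (- k)) (L1x T) i (1 - k)
    * lowM dot (fun i k => E i (- k)) (M2 T) (i - 1) (1 - k)
    * (lowL dot (fun i k => E i (- k)) (L1x T) i (- k)
    * lowM dot (fun i k => E i (- k)) (M2 T) i (1 - k))^*) != 0.
  rewrite /lowL /lowM opprK E1.
  have -> : - (1 - k - 1) = k by lia.
  rewrite (rep_sa_M2 hT (E (i - 1) (k - 1))) (rep_sa_M2 hT (E i (k - 1))).
  rewrite [dot _ (M2 T _)]dotC [dot (E i (k - 1)) (M2 T _)]dotC.
  move: hI; rewrite /l /m /lowL /lowM.
  case: (dot _ _) => ? ?; case: (dot _ _) => ? ?; case: (dot _ _) => ? ?.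
  case: (dot _ _) => ? ?; rewrite /=; apply: contraNneq => e; apply/eqP; lra.
move=> /(_ hI') [a3 a4].
apply: (@plaquette_nondegenerate _ (coshq q 1) (A1c p) (A2c p) _ _ (A0c p) (ANc p (N2 p))
   (ANc p (N1 p)) (coshq q 2) (lam p (idx1 p (i - 1))) (lam p (idx1 p i))
   (lam p (idx2 p (k - 1))) (lam p (idx2 p k)) _ _ _ _ a1 a3).
- exact: coshq_gt0.
- exact: coshq_gt0.
- exact: coshq_gt0.
- exact: coshq_gt0.
- by rewrite lam_eq // idx1_eq; lia.
- by rewrite /lam; apply: (sinhq_decr hq); rewrite idx2B; lra.
- by move: a2; rewrite -!(idx1B, idx2B) !bL_rot.
- by move: a4; rewrite -!(idx1B, idx2B) !bL_rot.
Qed.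
End SquarePhases.

Section Phases.
Variable R : realType.
Implicit Types z w : R[i].

(** The value 1 at zero keeps the modulus one everywhere. *)
Definition phase z : R[i] := if z == 0 then 1 else z^*%R / `|z|.

Lemma norm_phase z : `|phase z| = 1.
Proof.
rewrite /phase; case: eqVneq => [_|z0]; first by rewrite normr1.
by rewrite normf_div norm_conjC normr_id divff // normr_eq0.
Qed.

Lemma phase_mul z : phase z * z = `|z|.
Proof.
rewrite /phase; case: eqVneq => [->|z0]; first by rewrite mulr0 normr0.
by rewrite mulrAC [z^*%R * z]mulrC -normCK expr2 mulfK // normr_eq0.
Qed.

Lemma unit_conj z : `|z| = 1 -> z * z^*%R = 1.
Proof. by move=> h; rewrite -normCK h expr1n. Qed.

(** A gauge with prescribed ratios [f n] between neighbours. *)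
Fixpoint cumul (f : nat -> R[i]) (n : nat) : R[i] :=
  if n is n'.+1 then cumul f n' * f n else 1.

Lemma norm_cumul f n : (forall n, `|f n| = 1) -> `|cumul f n| = 1.
Proof. by move=> hf; elim: n => [|n IH] /=; rewrite ?normr1 // normrM IH hf mul1r. Qed.

Lemma cumulS f n : (forall n, `|f n| = 1) ->
  cumul f n.+1 * (cumul f n)^*%R = f n.+1.
Proof. by move=> hf; rewrite /= mulrAC unit_conj ?mul1r // norm_cumul. Qed.
End Phases.

(** * A choice of phases with real lowering entries *)

Section Gauge.
Variables (R : realType) (p : aw_data R).
Let q := qq p.
Hypothesis hq : 0 < q < 1.
Variables (V1 V2 W : vectType R[i]) (dotW : {dot W for (@Num.conj R[i])}).
Variables (tens : {bilinear V1 -> V2 -> W}) (T : aw2_ops V1 V2 W).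
Hypothesis hT : is_AW2_rep p dotW tens T.
Hypothesis hden : coefs_defined p.
Local Notation dot := dotW.

Lemma adapted_scale E (th : int -> int -> R[i]) : adapted_basis p dotW T E ->
  (forall i k, `|th i k| = 1) -> adapted_basis p dotW T (fun i k => th i k *: E i k).
Proof.
move=> [h1 h2 h3 h4 h5] hth; split.
- by move=> i k h; rewrite h1 // scaler0.
- by move=> i k h; rewrite !dotE h2 // mulr1 unit_conj.
- by move=> i k; rewrite endZ h3 scalerA mulrC -scalerA.
- by move=> i k; rewrite endZ h4 scalerA mulrC -scalerA.
- move=> w hw; apply: h5 => i k; have := hw i k; rewrite dotZr => /eqP.
  rewrite mulf_eq0 conjC_eq0 -normr_eq0 hth oner_eq0 /= => /eqP //.
Qed.

Lemma lowL_scale E (th : int -> int -> R[i]) i k :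
  lowL dotW (fun i k => th i k *: E i k) (L1x T) i k
  = th i k * (th (i - 1) k)^*%R * lowL dotW E (L1x T) i k.
Proof. by rewrite /lowL endZ !dotE mulrA. Qed.

Lemma lowM_scale E (th : int -> int -> R[i]) i k :
  lowM dotW (fun i k => th i k *: E i k) (M2 T) i k
  = th i k * (th i (k - 1))^*%R * lowM dotW E (M2 T) i k.
Proof. by rewrite /lowM endZ !dotE mulrA. Qed.

Lemma col_gauge E : adapted_basis p dotW T E ->
  exists th : int -> int -> R[i], (forall i k, `|th i k| = 1) /\
    forall i k, 0 <= lowM dotW (fun i k => th i k *: E i k) (M2 T) i k.
Proof.
move=> hE; pose f i (n : nat) := phase (lowM dotW E (M2 T) i n%:Z).
have hf i n : `|f i n| = 1 by exact: norm_phase.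
pose th i (k : int) := cumul (f i) `|k|%N.
exists th; split=> [i k|i k]; first exact: norm_cumul.
rewrite lowM_scale; case: (boolP (inrange p i k && inrange p i (k - 1))) => h; last first.
  by rewrite (m_out hT hE h) mulr0.
have [n ->] : exists n : nat, k = n.+1%:Z.
  by exists `|k - 1|%N; move: h; rewrite /inrange; lia.
rewrite /th; have -> : `|n.+1%:Z|%N = n.+1 by lia.
have -> : `|n.+1%:Z - 1|%N = n by lia.
by rewrite cumulS // phase_mul.
Qed.

(** With the entries of [M2] nonnegative, and nonzero inside the range, [plaquette_real] says that
    [l i k] times the conjugate of [l i (k - 1)] is real. Hence one phase serves all [k]. *)
Lemma row_gauge E : adapted_basis p dotW T E ->
  (forall i k, 0 <= lowM dotW E (M2 T) i k) ->
  forall i, exists r : R[i], `|r| = 1 /\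
    forall k, r * lowL dotW E (L1x T) i k \is Num.real.
Proof.
move=> hE hM i.
set l := lowL dotW E (L1x T); set m := lowM dotW E (M2 T).
(* The smallest [k] for which both (i, k) and (i - 1, k) can lie in the range. *)
pose k0 : int := if i - (N1 p)%:Z <= 0 then 0 else i - (N1 p)%:Z.
exists (phase (l i k0)); split; first exact: norm_phase.
have base : phase (l i k0) * l i k0 \is Num.real by rewrite phase_mul normr_real.
have key : forall n : nat, phase (l i k0) * l i (k0 + n%:Z) \is Num.real.
  elim=> [|n IH]; first by rewrite addr0.
  set k := k0 + n.+1%:Z; have Ek : k0 + n%:Z = k - 1 by rewrite /k; lia.
  rewrite Ek in IH.
  case: (boolP (inrange p i k && inrange p (i - 1) k)) => h; last first.
    by rewrite /l (l_out hT hE h) mulr0 real0.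
  have [h1 h2 h3 h4] : [/\ inrange p i k, inrange p (i - 1) k,
      inrange p i (k - 1) & inrange p (i - 1) (k - 1)].
    by move: h; rewrite /inrange /k /k0; case: ifP; split; lia.
  have pr := plaquette_real hq hT hden hE h1 h2 h3 h4.
  rewrite -/l -/m in pr.
  have hw : l i k * (l i (k - 1))^*%R \is Num.real.
    have m1 : m i k != 0 by apply: (m_neq0 hq hT hE).
    have m2 : m (i - 1) k != 0 by apply: (m_neq0 hq hT hE).
    have mr : (m (i - 1) k * m i k) \is Num.real by rewrite realM // ger0_real // hM.
    have mn : m (i - 1) k * m i k != 0 by rewrite mulf_neq0.
    have -> : l i k * (l i (k - 1))^*%R
        = (l i k * m (i - 1) k * (l i (k - 1) * m i k)^*%R) / (m (i - 1) k * m i k).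
      rewrite rmorphM /= (CrealP (ger0_real (hM i k))); field; by rewrite m1 m2.
    rewrite rpred_div // ?realV //.
    by move: pr; case: (_ * _^*%R) => a b /= ->; rewrite complex_real.
  (* A zero entry would break the chain of phases, but by [l_eq0] the next entry then vanishes as
     well. *)
  have [z0|z0] := eqVneq (l i (k - 1)) 0.
    have : l i k == 0 by rewrite /l (l_eq0 hq hT hE h1 h2 h3 h4) -/l z0.
    by move/eqP->; rewrite mulr0 real0.
  have -> : phase (l i k0) * l i k = (phase (l i k0) * l i (k - 1))
      * (l i k * (l i (k - 1))^*%R) / (l i (k - 1) * (l i (k - 1))^*%R).
    field; by rewrite conjC_eq0 z0.
  apply: rpred_div; first exact: realM.
  by rewrite -normCK rpredX // normr_real.
move=> k; case: (boolP (inrange p i k && inrange p (i - 1) k)) => h; last first.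
  by rewrite /l (l_out hT hE h) mulr0 real0.
have -> : k = k0 + `|k - k0|%N%:Z.
  by move: h; rewrite /inrange /k0; case: ifP; lia.
exact: key.
Qed.

(** The second correction [rho] depends on [i] only: it multiplies [l i k] by the phase from
    [row_gauge] and leaves the entries of [M2] unchanged. *)
Lemma gauge E : adapted_basis p dotW T E ->
  exists th : int -> int -> R[i],
  [/\ forall i k, `|th i k| = 1,
      forall i k, lowL dotW (fun i k => th i k *: E i k) (L1x T) i k \is Num.real &
      forall i k, lowM dotW (fun i k => th i k *: E i k) (M2 T) i k \is Num.real].
Proof.
move=> hE; have [th [hth hM]] := col_gauge hE.
have hE1 := adapted_scale hE hth.
have [r hr] := choice (row_gauge hE1 hM).
pose f (n : nat) := r n%:Z.
have hf n : `|f n| = 1 by case: (hr n%:Z).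
pose rho (i : int) := cumul f `|i|%N.
have hrho i : `|rho i| = 1 by exact: norm_cumul.
exists (fun i k => rho i * th i k); split=> [i k|i k|i k].
- by rewrite normrM hth hrho mulr1.
- rewrite lowL_scale rmorphM /=.
  have -> : rho i * th i k * ((rho (i - 1))^*%R * (th (i - 1) k)^*%R)
      * lowL dotW E (L1x T) i k = rho i * (rho (i - 1))^*%R
      * lowL dotW (fun i k => th i k *: E i k) (L1x T) i k.
    by rewrite lowL_scale; ring.
  case: (boolP (inrange p i k && inrange p (i - 1) k)) => h; last first.
    by rewrite (l_out hT hE1 h) mulr0 real0.
  have [n ->] : exists n : nat, i = n.+1%:Z.
    by exists `|i - 1|%N; move: h; rewrite /inrange; lia.
  rewrite /rho; have -> : `|n.+1%:Z|%N = n.+1 by lia.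
  have -> : `|n.+1%:Z - 1|%N = n by lia.
  by rewrite cumulS //; case: (hr n.+1%:Z).
- rewrite lowM_scale rmorphM /=.
  have -> : rho i * th i k * ((rho i)^*%R * (th i (k - 1))^*%R)
      * lowM dotW E (M2 T) i k = rho i * (rho i)^*%R
      * lowM dotW (fun i k => th i k *: E i k) (M2 T) i k.
    by rewrite lowM_scale; ring.
  by rewrite unit_conj // mul1r ger0_real.
Qed.
End Gauge.

(** * The nine-term formula *)

Lemma orthonormal_span (R : realType) (V : vectType R[i])
    (dot : {dot V for (@Num.conj R[i])}) (N : nat) (f : nat -> V) :
  \dim {:V} = N.+1 ->
  (forall j j', (j <= N)%N -> (j' <= N)%N -> dot (f j) (f j') = (j == j')%:R) ->
  forall v, exists c : nat -> R[i], v = \sum_(j < N.+1) c j *: f j.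
Proof.
move=> hd hf v; pose X := [tuple f j | j < N.+1].
have Xj (j : 'I_N.+1) : X`_j = f j by rewrite -tnth_nth tnth_mktuple.
have fX : free X.
  apply/freeP => c hc j.
  have : dot (\sum_(i < N.+1) c i *: X`_i) (f j) = 0 by rewrite hc dot0l.
  rewrite linear_sumlz /= (bigD1 j) //= big1 ?addr0 => [|i ij].
    by rewrite dotZl Xj hf ?leq_ord // eqxx mulr1.
  by rewrite dotZl Xj hf ?leq_ord // -val_eqE in ij *; rewrite (negbTE ij) mulr0.
have bX : basis_of fullv X by rewrite basisEfree fX subvf size_tuple hd leqnn.
exists (fun j => if insub j is Some i then coord X i v else 0).
rewrite {1}(coord_basis bX (memvf v)); apply: eq_bigr => j _.
by rewrite Xj valK.
Qed.

Section Eigenbasis.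
Variables (R : realType) (p : aw_data R).
Variables (V1 V2 W : vectType R[i]).
Variables (dot1 : {dot V1 for (@Num.conj R[i])}) (dot2 : {dot V2 for (@Num.conj R[i])}).
Variables (dotW : {dot W for (@Num.conj R[i])}).
Variables (tens : {bilinear V1 -> V2 -> W}) (T : aw2_ops V1 V2 W).
Hypothesis (hdim1 : \dim {:V1} = (N1 p).+1) (hdim2 : \dim {:V2} = (N2 p).+1).
Hypothesis htens : is_tensor_product dot1 dot2 dotW tens.
Hypothesis hT : is_AW2_rep p dotW tens T.

Lemma eigenbasis_adapted psi1 psi2 : is_eigenbasis p dot1 dot2 tens T psi1 psi2 ->
  adapted_basis p dotW T
    (fun i k => tens (psi1 (idx1 p i) (idx2 p k)) (psi2 (idx2 p k))).
Proof.
move=> hpsi.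
have out i k : ~~ inrange p i k ->
    tens (psi1 (idx1 p i) (idx2 p k)) (psi2 (idx2 p k)) = 0.
  move=> h; rewrite (psi1_out hpsi) ?linear0l // => /range12_idxP h'.
  by rewrite h' in h.
have rg2 (k : nat) : (k <= N2 p)%N -> range2 p (idx2 p k%:Z).
  by move=> hk; exists k => //; rewrite /idx2 -pmulrn.
split=> //.
- move=> i k /range12_idx h; rewrite htens.2 (psi1_on hpsi) // (psi2_on hpsi).
  + by rewrite !eqxx mulr1.
  + by case: h.
  + by case: h.
- move=> i k; case: (boolP (inrange p i k)) => h; last by rewrite out // linear0 scaler0.
  rewrite (rep_xK1 hT) id_lfunE (psi2_eig hpsi) ?linearZr_LR //.
  by case: (range12_idx h).
- move=> i k; case: (boolP (inrange p i k)) => h; last by rewrite out // linear0 scaler0.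
  by rewrite (psi1_eig hpsi) //; apply: range12_idx.
- move=> w hw.
  (* The basis of [V1] depends on the upper index, so [v] is expanded first and then [u], separately
     for each term. *)
  have tot u v : dotW w (tens u v) = 0.
    have [c ->] := @orthonormal_span _ _ dot2 (N2 p) (fun k => psi2 (idx2 p k%:Z)) hdim2
      (fun j j' hj hj' => etrans (psi2_on hpsi (rg2 _ hj) (rg2 _ hj'))
        (congr1 (fun b : bool => b%:R) (idx2_eq p _ _))) v.
    rewrite !linear_sumr /=; apply: big1 => k _; rewrite linearZr_LR /= dotZr.
    have rg1 (j : nat) : (j <= N1 p)%N -> range12 p (idx1 p (k%:Z + j%:Z)) (idx2 p k%:Z).
      by move=> hj; apply: range12_idx; rewrite /inrange; have := ltn_ord k; lia.
    have on1 j j' : (j <= N1 p)%N -> (j' <= N1 p)%N ->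
        dot1 (psi1 (idx1 p (k%:Z + j%:Z)) (idx2 p k%:Z))
             (psi1 (idx1 p (k%:Z + j'%:Z)) (idx2 p k%:Z)) = (j == j')%:R.
      move=> hj hj'; rewrite (psi1_on hpsi (rg1 _ hj) (rg1 _ hj')) idx1_eq.
      by congr (_%:R); congr nat_of_bool; lia.
    have [d ->] := orthonormal_span hdim1 on1 u.
    rewrite linear_sumlz /= linear_sumr /= big1 ?mulr0 // => j _.
    by rewrite linearZl_LR /= dotZr hw mulr0.
  apply: (@dot_eq0 _ _ dotW); have [s hs] := htens.1 w; rewrite {2}hs linear_sumr /=.
  by rewrite big1_seq // => x _; apply: tot.
Qed.
End Eigenbasis.

(** * Square roots and the coefficients of [L2] *)

Section Coefficients.
Variables (R : realType) (p : aw_data R).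
Let q := qq p.
Hypothesis hq : 0 < q < 1.
Variables (V1 V2 W : vectType R[i]) (dotW : {dot W for (@Num.conj R[i])}).
Variables (tens : {bilinear V1 -> V2 -> W}) (T : aw2_ops V1 V2 W).
Hypothesis hT : is_AW2_rep p dotW tens T.
Hypothesis hden : coefs_defined p.
Variable E : int -> int -> W.
Hypothesis hE : adapted_basis p dotW T E.
Local Notation dot := dotW.
Local Notation l := (lowL dotW E (L1x T)).
Local Notation m := (lowM dotW E (M2 T)).
Hypotheses (lR : forall i k, l i k \is Num.real) (mR : forall i k, m i k \is Num.real).

(** A real entry is itself a root of its squared modulus. The arguments determine (i, k), so the
    root can be prescribed at these points and taken as [sqrtC] elsewhere. *)
Lemma roots_L : exists ra : R -> R * R * R * R -> R[i], is_sqrt (asq q) ra /\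
  forall i k, inrange p i k || inrange p (i - 1) k ->
    aL p ra (idx1 p i) (idx2 p k) = l i k.
Proof.
have H (x : R * (R * R * R * R)) : exists z : R[i], z ^+ 2 = (asq q x.1 x.2)%:C /\
    forall i k, inrange p i k || inrange p (i - 1) k ->
    x = (idx1 p i - idx2 p k, alphaL p (idx2 p k)) -> z = l i k.
  case: (pselect (exists i k, inrange p i k || inrange p (i - 1) k /\
      x = (idx1 p i - idx2 p k, alphaL p (idx2 p k)))) => [[i [k [h ->]]]|h].
    exists (l i k); split=> [|i' k' _ [e1 e2]] /=.
      by rewrite -(l_sq hq hT hE h) (CrealP (lR i k)).
    have /eqP : idx2 p k = idx2 p k' by lra.
    rewrite idx2_eq => /eqP ek; subst k'.
    have /eqP : idx1 p i = idx1 p i' by lra.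
    by rewrite idx1_eq => /eqP ->.
  exists (sqrtC (asq q x.1 x.2)%:C); split=> [|i k hik e]; first exact: sqrtCK.
  by case: h; exists i, k.
have [f hf] := choice H.
exists (fun n b => f (n, b)); split=> [n b|i k h]; first by case: (hf (n, b)).
by case: (hf (idx1 p i - idx2 p k, alphaL p (idx2 p k))) => _ /(_ i k h erefl).
Qed.

Lemma roots_M : exists rta : R -> R * R * R * R -> R[i], is_sqrt (tasq q) rta /\
  forall i k, inrange p i k || inrange p i (k - 1) ->
    rta (idx2 p k) (alphaM p (idx1 p i)) = m i k.
Proof.
have H (x : R * (R * R * R * R)) : exists z : R[i], z ^+ 2 = (tasq q x.1 x.2)%:C /\
    forall i k, inrange p i k || inrange p i (k - 1) ->
    x = (idx2 p k, alphaM p (idx1 p i)) -> z = m i k.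
  case: (pselect (exists i k, inrange p i k || inrange p i (k - 1) /\
      x = (idx2 p k, alphaM p (idx1 p i)))) => [[i [k [h ->]]]|h].
    exists (m i k); split=> [|i' k' _ [e1 e2]] /=.
      by rewrite -(m_sq hq hT hE h) (CrealP (mR i k)).
    have /eqP := e1.
    rewrite idx2_eq => /eqP ek; subst k'.
    have /eqP : idx1 p i = idx1 p i' by lra.
    by rewrite idx1_eq => /eqP ->.
  exists (sqrtC (tasq q x.1 x.2)%:C); split=> [|i k hik e]; first exact: sqrtCK.
  by case: h; exists i, k.
have [f hf] := choice H.
exists (fun n b => f (n, b)); split=> [n b|i k h]; first by case: (hf (n, b)).
by case: (hf (idx2 p k, alphaM p (idx1 p i))) => _ /(_ i k h erefl).
Qed.

Variables ra rta : R -> R * R * R * R -> R[i].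
Hypothesis raE : forall i k, inrange p i k || inrange p (i - 1) k ->
  aL p ra (idx1 p i) (idx2 p k) = l i k.
Hypothesis rtaE : forall i k, inrange p i k || inrange p i (k - 1) ->
  rta (idx2 p k) (alphaM p (idx1 p i)) = m i k.

Lemma realC_real (x : R) : x%:C \is Num.real.
Proof. by apply/complex_realP; exists x. Qed.

Lemma coef_dE i k : inrange p i k || inrange p i (k - 1) ->
  coef_d p rta (idx1 p i) (idx2 p k) = (col_ratio p i)%:C * m i k.
Proof.
move=> h; rewrite /coef_d rtaE // den_E // /col_ratio /rot_im -/q.
by rewrite -mulrA -fmorph_div mulrC.
Qed.

Lemma entry_b i k : inrange p i k ->
  dot (L2 T (E i k)) (E (i - 1) k) = coef_b p ra (idx1 p i) (idx2 p k).
Proof.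
move=> h; rewrite (L2_row hq hT hE); last by clear; lia.
by rewrite /coef_b raE ?h // den_E // -mulrA -fmorph_div mulrC.
Qed.

Lemma entry_d i k : inrange p i k ->
  dot (L2 T (E i k)) (E i (k - 1)) = coef_d p rta (idx1 p i) (idx2 p k).
Proof.
move=> h; rewrite (L2_col hq hT hE); last by clear; lia.
by rewrite coef_dE ?h.
Qed.

Lemma entry_a i k : inrange p i k -> inrange p (i - 1) (k - 1) ->
  dot (L2 T (E i k)) (E (i - 1) (k - 1)) = coef_a p ra rta (idx1 p i) (idx2 p k).
Proof.
move=> h h'; have hF := adapted_frame hq hT hE.
have e := frame_corner hT hF i k; rewrite /= in e.
have h1 := range12_idx h; have h2 := range12_idx h'.
rewrite /coef_a -idx1B -idx2B !coef_dE ?h ?h' ?orbT // !raE ?h ?h' ?orbT //.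
rewrite idx1B idx2B in h2; have d0 := hden.1 _ _ h1 h2.
rewrite /den_a -idx1B -idx2B in d0 *.
move: d0 e; move: (bL _ _ _ - bL _ _ _) => D; rewrite -(fmorph_eq0 (real_complex R)).
by move=> d0 e; rewrite -[LHS](mulfK d0) e; congr (_ / _); ring.
Qed.

(** The corner formula of the reflected frame; it contains conjugated entries of [M2], which are
    real here. *)
Lemma entry_c i k : inrange p i k -> inrange p (i - 1) (k + 1) ->
  dot (L2 T (E i k)) (E (i - 1) (k + 1)) = coef_c p ra rta (idx1 p i) (idx2 p k).
Proof.
move=> h h'; have hF := frame_reflect hT (adapted_frame hq hT hE).
have := frame_corner hT hF i (- k); rewrite /lowL /lowM /= opprK.
have -> : - (- k - 1) = k + 1 by clear; lia.
rewrite (rep_sa_M2 hT (E (i - 1) k)) (rep_sa_M2 hT (E i k)).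
rewrite [dot _ (M2 T _)]dotC [dot (E i k) (M2 T _)]dotC => e.
have cm j n : (dot (M2 T (E j (n + 1))) (E j n))^*%R = m j (n + 1).
  by have := CrealP (mR j (n + 1)); rewrite /lowM addrK.
rewrite !cm -!/(l _ _) in e.
have h1 := range12_idx h; have h2 := range12_idx h'.
have h3 : inrange p i (k + 1) || inrange p i (k + 1 - 1) by rewrite addrK h orbT.
have h4 : inrange p (i - 1) (k + 1) || inrange p (i - 1) (k + 1 - 1) by rewrite h'.
have h5 : inrange p i (k + 1) || inrange p (i - 1) (k + 1) by rewrite h' orbT.
rewrite /coef_c -idx1B -idx2D !coef_dE // !raE ?h //.
rewrite idx1B idx2D in h2; have d0 := hden.2 _ _ h1 h2.
rewrite /den_c -idx1B -idx2D in d0 *.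
move: d0 e; move: (bL _ _ _ - bL _ _ _) => D; rewrite -(fmorph_eq0 (real_complex R)).
by move=> d0 e; rewrite -[LHS](mulfK d0) e; congr (_ / _); ring.
Qed.

Lemma coef_b_real i k : inrange p i k -> coef_b p ra (idx1 p i) (idx2 p k) \is Num.real.
Proof.
move=> h; rewrite /coef_b raE ?h //; apply: rpred_div; last exact: realC_real.
by apply: rpredM; [exact: lR | exact: realC_real].
Qed.

Lemma coef_d_real i k : inrange p i k || inrange p i (k - 1) ->
  coef_d p rta (idx1 p i) (idx2 p k) \is Num.real.
Proof. by move=> h; rewrite coef_dE //; apply: rpredM; [exact: realC_real | exact: mR]. Qed.

Lemma coef_a_real i k : inrange p i k -> inrange p (i - 1) (k - 1) ->
  coef_a p ra rta (idx1 p i) (idx2 p k) \is Num.real.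
Proof.
move=> h h'; rewrite /coef_a -idx1B -idx2B !raE ?h ?h' ?orbT //.
apply: rpred_div; last exact: realC_real.
by apply: rpredB; apply: rpredM; rewrite ?lR // coef_d_real // ?h ?h' ?orbT.
Qed.

Lemma coef_c_real i k : inrange p i k -> inrange p (i - 1) (k + 1) ->
  coef_c p ra rta (idx1 p i) (idx2 p k) \is Num.real.
Proof.
move=> h h'; rewrite /coef_c -idx1B -idx2D !raE ?h ?h' ?orbT //.
apply: rpred_div; last exact: realC_real.
by apply: rpredB; apply: rpredM; rewrite ?lR // coef_d_real // ?addrK ?h ?h' ?orbT.
Qed.

(** This is where real phases are used for the nine terms: the raising coefficients are the lowering
    ones at the target, without conjugation. *)
Lemma L2_sym i k i' k' x : x \is Num.real -> dot (L2 T (E i' k')) (E i k) = x ->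
  dot (L2 T (E i k)) (E i' k') = x.
Proof. by move=> xR e; rewrite (rep_sa_L2 hT) dotC e (CrealP xR). Qed.

Lemma L2_nine_term i k : inrange p i k ->
  let n1 := idx1 p i in let n2 := idx2 p k in
  let a := coef_a p ra rta in let b := coef_b p ra in
  let c := coef_c p ra rta in let d := coef_d p rta in
  L2 T (E i k) =
      a n1 n2 *: E (i - 1) (k - 1) + b n1 n2 *: E (i - 1) k
    + c n1 n2 *: E (i - 1) (k + 1) + d n1 n2 *: E i (k - 1)
    + coef_e p n1 n2 *: E i k + d n1 (n2 + 1) *: E i (k + 1)
    + c (n1 + 1) (n2 - 1) *: E (i + 1) (k - 1) + b (n1 + 1) n2 *: E (i + 1) k
    + a (n1 + 1) (n2 + 1) *: E (i + 1) (k + 1).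
Proof.
move=> h n1 n2 a b c d.
(* At a zero target vector the coefficient may be anything, so only targets in range matter; there
   the denominators of the corners are nonzero. *)
have onE i' k' x : (inrange p i' k' -> dot (L2 T (E i k)) (E i' k') = x) ->
    dot (L2 T (E i k)) (E i' k') *: E i' k' = x *: E i' k'.
  case: (boolP (inrange p i' k')) => [_ -> //|h' _].
  by rewrite (ab_out hE h') !scaler0.
rewrite [LHS](ab_expand hq hT hE (s := [:: (i - 1, k - 1); (i - 1, k); (i - 1, k + 1);
  (i, k - 1); (i, k); (i, k + 1); (i + 1, k - 1); (i + 1, k); (i + 1, k + 1)])).
- rewrite !big_cons big_nil /= addr0 !addrA /n1 /n2 -!(idx1D, idx2D, idx2B).
  rewrite (onE (i - 1) (k - 1) _ (entry_a h)).
  rewrite (onE (i - 1) k _ (fun=> entry_b h)).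
  rewrite (onE (i - 1) (k + 1) _ (entry_c h)).
  rewrite (onE i (k - 1) _ (fun=> entry_d h)).
  rewrite (onE i k (coef_e p (idx1 p i) (idx2 p k))); last first.
    by rewrite (L2_diag hq hT hE) (ab_norm hE h) mulr1.
  rewrite (onE i (k + 1) (d (idx1 p i) (idx2 p (k + 1)))); last first.
    move=> h'; apply: L2_sym; first by apply: coef_d_real; rewrite h'.
    by have := entry_d h'; rewrite addrK.
  rewrite (onE (i + 1) (k - 1) (c (idx1 p (i + 1)) (idx2 p (k - 1)))); last first.
    move=> h'; apply: L2_sym; first by apply: coef_c_real => //; rewrite addrK subrK.
    by have := entry_c h'; rewrite addrK subrK; apply.
  rewrite (onE (i + 1) k (b (idx1 p (i + 1)) (idx2 p k))); last first.
    move=> h'; apply: L2_sym; first exact: coef_b_real.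
    by have := entry_b h'; rewrite addrK.
  rewrite (onE (i + 1) (k + 1) (a (idx1 p (i + 1)) (idx2 p (k + 1)))) // => h'.
  apply: L2_sym; first by apply: coef_a_real => //; rewrite !addrK.
  by have := entry_a h'; rewrite !addrK; apply.
- by rewrite /= !inE !xpair_eqE; clear; lia.
- move=> i' k'; rewrite !inE !xpair_eqE => hn; apply: (L2_eq0 hq hT hE).
  by move: hn; clear; lia.
Qed.
End Coefficients.

Theorem theorem5p5 (R : realType) (p : aw_data R) (hq : 0 < qq p < 1)
  (V1 V2 W : vectType R[i])
  (dot1 : {dot V1 for (@Num.conj R[i])})
  (dot2 : {dot V2 for (@Num.conj R[i])})
  (dotW : {dot W for (@Num.conj R[i])})
  (tens : {bilinear V1 -> V2 -> W})
  (hdim1 : \dim {:V1} = (N1 p).+1) (hdim2 : \dim {:V2} = (N2 p).+1)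
  (htens : is_tensor_product dot1 dot2 dotW tens)
  (T : aw2_ops V1 V2 W) (hT : is_AW2_rep p dotW tens T)
  (psi1 : R -> R -> V1) (psi2 : R -> V2)
  (hpsi : is_eigenbasis p dot1 dot2 tens T psi1 psi2)
  (hden : coefs_defined p) :
  exists (theta : R -> R -> R[i]) (ra rta : R -> R * R * R * R -> R[i]),
    let Psi n1 n2 := tens (theta n1 n2 *: psi1 n1 n2) (psi2 n2) in
    let a := coef_a p ra rta in
    let b := coef_b p ra in
    let c := coef_c p ra rta in
    let d := coef_d p rta in
    let e := coef_e p in
    [/\ forall n1 n2, `|theta n1 n2| = 1,
        is_sqrt (asq (qq p)) ra,
        is_sqrt (tasq (qq p)) rta
      & forall n1 n2, range12 p n1 n2 ->
        L2 T (Psi n1 n2) =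
            a n1 n2 *: Psi (n1 - 1) (n2 - 1)
          + b n1 n2 *: Psi (n1 - 1) n2
          + c n1 n2 *: Psi (n1 - 1) (n2 + 1)
          + d n1 n2 *: Psi n1 (n2 - 1)
          + e n1 n2 *: Psi n1 n2
          + d n1 (n2 + 1) *: Psi n1 (n2 + 1)
          + c (n1 + 1) (n2 - 1) *: Psi (n1 + 1) (n2 - 1)
          + b (n1 + 1) n2 *: Psi (n1 + 1) n2
          + a (n1 + 1) (n2 + 1) *: Psi (n1 + 1) (n2 + 1)].
Proof.
have hE0 := eigenbasis_adapted hdim1 hdim2 htens hT hpsi.
have [th [th1 lR mR]] := gauge hq hT hden hE0.
have hE := adapted_scale hE0 th1.
have [ra [hra raE]] := roots_L hq hT hE lR.
have [rta [hrta rtaE]] := roots_M hq hT hE mR.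
(* Extends the phases from the integer lattice to all pairs of reals, with value 1 off the
   lattice. *)
have H (x : R * R) : exists z : R[i], `|z| = 1 /\
    forall i k, x = (idx1 p i, idx2 p k) -> z = th i k.
  case: (pselect (exists i k, x = (idx1 p i, idx2 p k))) => [[i [k ->]]|h].
    exists (th i k); split=> // i' k' [/eqP + /eqP].
    by rewrite idx1_eq idx2_eq => /eqP-> /eqP->.
  by exists 1; split=> [|i k e]; [rewrite normr1 | case: h; exists i, k].
have [f hf] := choice H.
exists (fun n1 n2 => f (n1, n2)), ra, rta => Psi a b c d e.
split=> // [n1 n2|n1 n2 /idx_range12[i [k [h -> ->]]]]; first by case: (hf (n1, n2)).
have PsiE j n : Psi (idx1 p j) (idx2 p n)
    = th j n *: tens (psi1 (idx1 p j) (idx2 p n)) (psi2 (idx2 p n)).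
  by rewrite /Psi linearZl_LR /=; have [_ /(_ j n erefl) ->] := hf (idx1 p j, idx2 p n).
have := L2_nine_term hq hT hden hE lR mR raE rtaE h; rewrite -!PsiE => /= ->.
by rewrite !(idx1B, idx1D, idx2B, idx2D).
Qed.
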